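(* Let $P$ be a finite Eulerian Sheffer poset of even rank $n=2m+2\geq 6$ with $B(3)=6$ and $D(3)=8$. Then $P$ has the same factorial functions as the cubical lattice of rank $n$, namely $D(k)=2^{k-1}(k-1)!$ for $1\leq k\leq n$ and $B(k)=k!$ for $1\leq k\leq n-1$.
   Context: A finite graded poset with minimum $\hat 0$ and maximum $\hat 1$ is Eulerian if every interval $[x,y]$ with $x<y$ has as many elements of even rank as of odd rank. A finite Sheffer poset is a finite poset with $\hat 0$ and $\hat 1$ in which every interval is graded, any two intervals $[\hat 0,y]$ of the same length $n$ have the same number $D(n)$ of maximal chains (Sheffer factorial function), and any two intervals $[x,y]$ of the same length $n$ with $x\neq\hat 0$ have the same number $B(n)$ of maximal chains (binomial factorial function). *)

(* Defs.v *)
From HB Require Import structures.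
From mathcomp Require Import all_boot all_order.

Set Implicit Arguments.
Unset Strict Implicit.
Unset Printing Implicit Defensive.

Import Order.LTheory.
Local Open Scope order_scope.

Section Posets.
Context {d : Order.disp_t} {T : finTBPOrderType d}.
Implicit Types (x y z : T) (C : {set T}).

Definition poset_interval x y : {set T} := [set z | x <= z <= y].

Definition is_chain C : bool :=
  [forall u in C, forall v in C, (u <= v) || (v <= u)].

Definition chain_in x y C : bool := (C \subset poset_interval x y) && is_chain C.

Definition max_chains x y : {set {set T}} :=
  [set C | maxset (chain_in x y) C].

(* A chain with k + 1 elements has length k. *)
Definition chain_length C : nat := #|C|.-1.

Definition interval_length x y : nat :=
  (\max_(C in max_chains x y) chain_length C)%N.

Definition graded_interval x y : Prop :=
  {in max_chains x y &, forall C1 C2, chain_length C1 = chain_length C2}.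

Definition rank x : nat := interval_length \bot x.

End Posets.

Definition poset_rank (d : Order.disp_t) (T : finTBPOrderType d) : nat :=
  rank (\top : T).

Definition eulerian (d : Order.disp_t) (T : finTBPOrderType d) : Prop :=
  graded_interval (\bot : T) \top /\
  forall x y : T, x < y ->
    #|[set z in poset_interval x y | ~~ odd (rank z)]| =
    #|[set z in poset_interval x y | odd (rank z)]|.

(* [D] and [B] are total functions, but only their values at lengths of
   intervals that occur in [T] are constrained. *)
Definition sheffer_poset (d : Order.disp_t) (T : finTBPOrderType d)
    (D B : nat -> nat) : Prop :=
  [/\ forall x y : T, x <= y -> graded_interval x y,
      forall y : T, #|max_chains \bot y| = D (interval_length \bot y)
    & forall x y : T, x != \bot -> x <= y ->
        #|max_chains x y| = B (interval_length x y)].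

(* Face lattice of the cube [0,1]^e. [None] is the empty face; [Some f] is the
   face on which coordinate [i] equals [b] when [f i = Some b] and ranges over
   [0,1] when [f i = None]. *)
Definition cube_face (e : nat) : Type := option {ffun 'I_e -> option bool}.

HB.instance Definition _ (e : nat) := Finite.on (cube_face e).

Section CubeFace.
Variable e : nat.
Implicit Types F G H : cube_face e.

Definition cube_face_le F G : bool :=
  match F, G with
  | None, _ => true
  | Some _, None => false
  | Some f, Some g => [forall i, (g i == None) || (g i == f i)]
  end.

Fact cube_face_le_refl : reflexive cube_face_le.
Proof. by case=> //= f; apply/forallP => i; rewrite eqxx orbT. Qed.

Fact cube_face_le_anti : antisymmetric cube_face_le.
Proof.
case=> [f|] [g|] //= /andP[/forallP fg /forallP gf].
congr Some; apply/ffunP => i.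
by have := fg i; have := gf i; case: (f i) (g i) => [[]|] [[]|].
Qed.

Fact cube_face_le_trans : transitive cube_face_le.
Proof.
case=> [g|] [f|] [h|] //= /forallP fg /forallP gh; apply/forallP => i.
by have := fg i; have := gh i; case: (f i) (g i) (h i) => [[]|] [[]|] [[]|].
Qed.

Fact cube_face_display : Order.disp_t. Proof. exact: Order.Disp tt tt. Qed.

HB.instance Definition _ := Order.Le_isPOrder.Build cube_face_display
  (cube_face e) cube_face_le_refl cube_face_le_anti cube_face_le_trans.

Fact cube_face_le0 F : (None : cube_face e) <= F.
Proof. by []. Qed.

Definition full_cube : cube_face e := Some [ffun=> None].

Fact cube_face_le1 F : F <= full_cube.
Proof. by case: F => //= f; apply/forallP => i; rewrite ffunE eqxx. Qed.

HB.instance Definition _ := Order.hasBottom.Build cube_face_display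
  (cube_face e) cube_face_le0.
HB.instance Definition _ := Order.hasTop.Build cube_face_display
  (cube_face e) cube_face_le1.

End CubeFace.

(* The face lattice of the (n-1)-dimensional cube has rank n. *)
Definition cubical_lattice (n : nat) : finTBPOrderType cube_face_display :=
  cube_face n.-1.

(* Main.v *)
Require Import Defs.
From mathcomp Require Import all_boot all_order all_algebra zify ring lra.

(**
Counting maximal chains through the elements of a fixed rank expresses every
level size of an interval by D and B, so the Eulerian condition becomes an
alternating sum identity among the 1 / (B i * B (N - i)), respectively the
1 / (D i * B (N - i)). For even N it determines B(N) or D(N) from the earlier
values, and we induct on even M with B(k) = k! and D(k) = 2^(k-1) (k-1)! for
k <= M.

At rank M + 2 there are three unknown integers a = B(M+1) / B(M),
c = D(M+1) / D(M) and C = D(M+2) / D(M+1), with c >= M and C >= a, tied by one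
equation. Finitely many types of solutions remain; they are excluded by
looking at the atom sets of the coatoms of an interval. Because two coatoms of
an interval with B(k) = k! have exactly one common ridge, the size of the
intersection of the atom sets of two coatoms is a multiple of the number of
atoms below a ridge.
 - The equation forces a < 2M; then any two coatoms of an interval of length
   M + 1 above an atom share an atom, and counting gives a = M + 1.
 - Now C (2(M+1) - c) = 4(M+1) with C >= M+1, so c is one of 2M-2, ..., 2M+1. If
   c < 2M, distinct coatoms of an element of rank M + 2 share at most one ridge,
   so c < C, which is false.
 - If c = 2M+1, each coatom s of an element of rank M + 1 has one more coatom
   disjoint from it than coatoms with the same atoms; this is contradictory.
Hence c = 2M and C = 2(M+1).
*)

Set Implicit Arguments.
Unset Strict Implicit.
Unset Printing Implicit Defensive.

Import Order.LTheory GRing.Theory Num.Theory.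

(** * Maximal chains and rank functions *)

Section MaximalChains.
Local Open Scope order_scope.
Context {d : Order.disp_t} {T : finTBPOrderType d}.
Implicit Types (x y z w : T) (C : {set T}).

Definition covers x w := (x < w) && [forall z, ~~ ((x < z) && (z < w))].

Lemma coversP x w :
  reflect (x < w /\ forall z, x < z -> ~~ (z < w)) (covers x w).
Proof.
apply: (iffP andP) => -[lt_xw H]; split=> //.
  by move=> z lt_xz; have := forallP H z; rewrite lt_xz.
by apply/forallP => z; apply/negP => /andP[/H/negP].
Qed.

Lemma covers_lt x w : covers x w -> x < w.
Proof. by case/andP. Qed.

Lemma is_chainP C :
  reflect {in C &, forall u v, (u <= v) || (v <= u)} (is_chain C).
Proof.
apply: (iffP 'forall_in_forall_inP) => H u v uC vC; exact: H.
Qed.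

Lemma sub_chain (A C : {set T}) : A \subset C -> is_chain C -> is_chain A.
Proof.
move=> /subsetP sAC /is_chainP H; apply/is_chainP => u v /sAC uC /sAC vC.
exact: H.
Qed.

Lemma chainU1 z C :
  is_chain C -> {in C, forall u, (u <= z) || (z <= u)} -> is_chain (z |: C).
Proof.
move=> /is_chainP chC H; apply/is_chainP => u v /setU1P[->|uC] /setU1P[->|vC].
- by rewrite lexx.
- by rewrite orbC H.
- exact: H.
- exact: chC.
Qed.

Lemma poset_intervalP x y z : reflect (x <= z /\ z <= y) (z \in poset_interval x y).
Proof. by rewrite inE; apply: andP. Qed.

Lemma max_chainP x y C :
  reflect [/\ C \subset poset_interval x y, is_chain C &
             forall E : {set T}, E \subset poset_interval x y -> is_chain E ->
               C \subset E -> E = C]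
          (C \in max_chains x y).
Proof.
rewrite inE; apply: (iffP maxsetP) => [[/andP[sC chC] H] | [sC chC H]].
  by split=> // E sE chE sCE; apply: H => //; apply/andP.
by split=> [|E /andP[sE chE] sCE]; [apply/andP | apply: H].
Qed.

Lemma max_chain_absorb x y C z : C \in max_chains x y ->
  z \in poset_interval x y -> {in C, forall u, (u <= z) || (z <= u)} -> z \in C.
Proof.
case/max_chainP=> sC chC H zI zC; rewrite -(H (z |: C)) ?setU11 ?subsetU1 //.
  by rewrite subUset sub1set zI.
exact: chainU1.
Qed.

Lemma max_chain_bot x y C : x <= y -> C \in max_chains x y -> x \in C.
Proof.
move=> le_xy CM; apply: (max_chain_absorb CM); first by rewrite inE lexx.
case/max_chainP: CM => /subsetP sC _ _ u /sC/poset_intervalP[-> _].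
by rewrite orbT.
Qed.

Lemma max_chain_top x y C : x <= y -> C \in max_chains x y -> y \in C.
Proof.
move=> le_xy CM; apply: (max_chain_absorb CM); first by rewrite inE lexx le_xy.
by case/max_chainP: CM => /subsetP sC _ _ u /sC/poset_intervalP[_ ->].
Qed.

Lemma max_chain_exists x y : {C | C \in max_chains x y}.
Proof.
have ch0 : chain_in x y set0.
  by rewrite /chain_in sub0set; apply/is_chainP => u v; rewrite inE.
by have [C CM _] := maxset_exists ch0; exists C; rewrite inE.
Qed.

Lemma card_max_chains_gt0 x y : (0 < #|max_chains x y|)%N.
Proof. by have [C CM] := max_chain_exists x y; rewrite (cardD1 C) CM. Qed.

Lemma max_chains_id x : max_chains x x = [set [set x]].
Proof.
have I1 : poset_interval x x = [set x].
  by apply/setP => z; rewrite !inE -eq_le eq_sym.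
apply/setP => C; rewrite in_set1; apply/idP/eqP => [CM | ->].
  apply/eqP; rewrite eqEsubset -{1}I1 sub1set (max_chain_bot _ CM) ?lexx //.
  by case/max_chainP: CM => ->.
apply/max_chainP; split; rewrite ?I1 ?subxx //.
  by apply/is_chainP => u v /set1P-> /set1P->; rewrite lexx.
by move=> E sE _ s1E; apply/eqP; rewrite eqEsubset sE.
Qed.

(** Nothing lies strictly between [x] and [w], so a chain extending [x |: C] consists of [x] and
    elements of the interval from [w] to [y], where [C] is already maximal. *)
Lemma max_chains_cover x y w C : covers x w -> w <= y ->
  C \in max_chains w y -> x |: C \in max_chains x y.
Proof.
move=> cov le_wy CM; have [sC chC maxC] := max_chainP _ _ _ CM.
have [lt_xw Hcov] := coversP _ _ cov.
have sCx u : u \in C -> x < u.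
  by move/(subsetP sC)/poset_intervalP=> [le_wu _]; apply: lt_le_trans le_wu.
apply/max_chainP; split.
- apply/subsetP => u /setU1P[->|uC].
    by rewrite inE lexx (le_trans (ltW lt_xw) le_wy).
  have /poset_intervalP[_ le_uy] := subsetP sC u uC.
  by rewrite inE le_uy ltW // sCx.
- by apply: chainU1 => // u /sCx/ltW->; rewrite orbT.
move=> E sE chE sCE.
have xE : x \in E by rewrite (subsetP sCE) // setU11.
have wE : w \in E.
  by rewrite (subsetP sCE) // inE (max_chain_bot le_wy CM) orbT.
rewrite -(setD1K xE); congr (_ |: _); apply: maxC.
- apply/subsetP => u; rewrite !inE => /andP[ne_ux uE].
  have /poset_intervalP[le_xu ->] := subsetP sE u uE; rewrite andbT.
  have lt_xu : x < u by rewrite lt_neqAle eq_sym ne_ux.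
  have := is_chainP _ chE u w uE wE; rewrite [u <= w]le_eqVlt.
  by rewrite (negPf (Hcov u lt_xu)) orbF => /orP[/eqP->|].
- by apply: sub_chain chE; apply: subsetDl.
apply/subsetP => u uC; rewrite !inE gt_eqF ?sCx //=.
by rewrite (subsetP sCE) // inE uC orbT.
Qed.

Lemma max_chain_cover x y C : x < y -> C \in max_chains x y ->
  exists w, [/\ covers x w, w <= y, w \in C & C :\ x \in max_chains w y].
Proof.
move=> lt_xy CM; have [/subsetP sC chC maxC] := max_chainP _ _ _ CM.
have xC := max_chain_bot (ltW lt_xy) CM; have yC := max_chain_top (ltW lt_xy) CM.
have y_Cx : y \in C :\ x by rewrite !inE yC gt_eqF.
pose below u := #|[set v in C | v < u]|.
(* The cover [w] is the least element of [C] other than [x], found as the one with the fewest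
   elements of [C] below it. *)
case: (arg_minnP below y_Cx) => w /setD1P[ne_wx wC] w_min.
have lt_xw : x < w.
  by rewrite lt_neqAle eq_sym ne_wx; have /poset_intervalP[] := sC w wC.
have le_wy : w <= y by have /poset_intervalP[] := sC w wC.
have w_le u : u \in C -> u != x -> w <= u.
  move=> uC ne_ux; have /orP[//|] := is_chainP _ chC w u wC uC.
  rewrite le_eqVlt => /orP[/eqP->//|lt_uw].
  suff : (below u < below w)%N by rewrite ltnNge w_min //; apply/setD1P.
  apply: proper_card; apply/properP; split.
    apply/subsetP => v; rewrite !inE => /andP[-> lt_vu] /=.
    exact: lt_trans lt_uw.
  by exists u; rewrite !inE uC ?lt_uw ?ltxx.
have cov : covers x w.
  apply/coversP; split=> // z lt_xz; apply/negP => lt_zw.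
  have zC : z \in C.
    apply: (max_chain_absorb CM).
      by rewrite inE (ltW lt_xz) (le_trans (ltW lt_zw) le_wy).
    move=> u uC; have [->|ne_ux] := eqVneq u x; first by rewrite ltW.
    by rewrite orbC (le_trans (ltW lt_zw)) // w_le.
  by have := w_le z zC; rewrite gt_eqF // => /(_ isT); rewrite (lt_geF lt_zw).
exists w; split=> //; apply/max_chainP; split.
- apply/subsetP => u; rewrite !inE => /andP[ne_ux uC].
  by rewrite w_le //; have /poset_intervalP[] := sC u uC.
- by apply: sub_chain chC; apply: subsetDl.
move=> E /subsetP sE chE sCE.
have sEx u : u \in E -> x < u.
  by move/sE/poset_intervalP=> [le_wu _]; apply: lt_le_trans le_wu.
have <- : x |: E = C.
  apply: maxC; last by rewrite -(setD1K xC) setUS.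
    apply/subsetP => u /setU1P[->|uE]; first by rewrite inE lexx ltW.
    by rewrite inE (ltW (sEx u uE)); have /poset_intervalP[] := sE u uE.
  by apply: chainU1 => // u /sEx/ltW->; rewrite orbT.
apply/setP => u; rewrite !inE; have [->|//] := eqVneq u x.
by apply/negP => /sEx; rewrite ltxx.
Qed.

Lemma covers_exists x y : x < y -> exists2 w, covers x w & w <= y.
Proof.
move=> lt_xy; have [C CM] := max_chain_exists x y.
by have [w [cov le_wy _ _]] := max_chain_cover lt_xy CM; exists w.
Qed.

Lemma covers_chain_inj x C w w' : is_chain C -> w \in C -> w' \in C ->
  covers x w -> covers x w' -> w = w'.
Proof.
move=> /is_chainP chC wC w'C /coversP[lt_xw Hw] /coversP[lt_xw' Hw'].
have := chC w w' wC w'C; rewrite !le_eqVlt (negPf (Hw _ lt_xw')).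
by rewrite (negPf (Hw' _ lt_xw)) !orbF => /orP[]/eqP.
Qed.

(** Each maximal chain contains exactly one cover [w] of [x], and deleting [x] matches the chains
    through [w] with the maximal chains from [w] to [y]. *)
Lemma card_max_chains_rec x y : x < y ->
  (#|max_chains x y| = \sum_(w | covers x w && (w <= y)%O) #|max_chains w y|)%N.
Proof.
move=> lt_xy.
have uniq_w C : C \in max_chains x y ->
    (\sum_(w | [&& covers x w, (w <= y)%O & w \in C]) 1 = 1)%N.
  move=> CM; have [w [cov le_wy wC _]] := max_chain_cover lt_xy CM.
  have [_ chC _] := max_chainP _ _ _ CM.
  rewrite (eq_bigl (pred1 w)) ?big_pred1_eq // => w' /=; apply/and3P/eqP.
    by case=> cov' _ w'C; apply: (covers_chain_inj chC w'C wC cov' cov).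
  by move=> ->.
rewrite -sum1_card -(eq_bigr _ uniq_w).
rewrite (exchange_big_dep (fun w => covers x w && (w <= y))) /=; last first.
  by move=> C w _ /and3P[-> ->].
apply: eq_bigr => w /andP[cov le_wy]; rewrite sum1dep_card.
have <- : [set x |: E | E in max_chains w y]
    = [set C | (C \in max_chains x y) && [&& covers x w, w <= y & w \in C]].
  apply/setP => C; rewrite inE cov le_wy /=; apply/imsetP/andP.
    case=> E EM ->; split; first exact: max_chains_cover EM.
    by rewrite inE (max_chain_bot le_wy EM) orbT.
  case=> CM wC; have [w' [cov' _ w'C EM]] := max_chain_cover lt_xy CM.
  have [_ chC _] := max_chainP _ _ _ CM.
  rewrite (covers_chain_inj chC w'C wC cov' cov) in EM.
  by exists (C :\ x); rewrite // setD1K // (max_chain_bot (ltW lt_xy) CM).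
rewrite card_in_imset // => E F EM FM eqEF.
have notx G : G \in max_chains w y -> x \notin G.
  case/max_chainP=> /subsetP sG _ _; apply/negP => /sG/poset_intervalP[le_wx _].
  by have := lt_le_trans (covers_lt cov) le_wx; rewrite ltxx.
by rewrite -(setU1K (notx E EM)) -(setU1K (notx F FM)) eqEF.
Qed.

Lemma card_above_lt x w : x < w -> (#|[set z | (w <= z)%O]| < #|[set z | (x <= z)%O]|)%N.
Proof.
move=> lt_xw; apply: proper_card; apply/properP; split.
  by apply/subsetP => z; rewrite !inE; apply: le_trans (ltW lt_xw).
by exists x; rewrite !inE ?lexx // (lt_geF lt_xw).
Qed.

(** Induction on the number of elements above [x], which drops when [x] is replaced by a cover. *)
Lemma le_cover_ind (Q : T -> T -> Prop) :
  (forall x, Q x x) ->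
  (forall x y, x < y -> (forall w, covers x w -> w <= y -> Q w y) -> Q x y) ->
  forall x y, x <= y -> Q x y.
Proof.
move=> Q0 QS x y; have [k] := ubnP #|[set z | x <= z]|.
elim: k x => // k IH x le_k; rewrite le_eqVlt => /orP[/eqP->//|lt_xy].
apply: QS => // w cov le_wy; apply: IH => //.
exact: leq_trans (card_above_lt (covers_lt cov)) le_k.
Qed.

Lemma interval_length_card x y C : graded_interval x y ->
  C \in max_chains x y -> interval_length x y = #|C|.-1.
Proof.
move=> grd CM; apply/eqP; rewrite eqn_leq; apply/andP; split.
  by apply/bigmax_leqP => E EM; rewrite (grd E C EM CM).
rewrite /interval_length; exact: leq_bigmax_cond.
Qed.

(** * Lengths and ranks when all intervals are graded *)

Section Graded.
Hypothesis graded : forall x y, x <= y -> graded_interval x y.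

Lemma interval_length_id x : interval_length x x = 0.
Proof.
have CM : [set x] \in max_chains x x by rewrite max_chains_id set11.
by rewrite (interval_length_card (graded (lexx x)) CM) cards1.
Qed.

Lemma interval_length_rec x w y : covers x w -> w <= y ->
  interval_length x y = (interval_length w y).+1.
Proof.
move=> cov le_wy; have [C CM] := max_chain_exists w y.
have lt_xw := covers_lt cov; have le_xy := le_trans (ltW lt_xw) le_wy.
rewrite (interval_length_card (graded le_wy) CM).
rewrite (interval_length_card (graded le_xy) (max_chains_cover cov le_wy CM)).
have xC : x \notin C.
  apply/negP; case/max_chainP: CM => /subsetP sC _ _ /sC/poset_intervalP[].
  by rewrite (lt_geF lt_xw).
rewrite cardsU1 xC add1n /= prednK // (cardD1 w).
by rewrite (max_chain_bot le_wy CM).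
Qed.

Lemma interval_length_add x y z : x <= y -> y <= z ->
  interval_length x z = (interval_length x y + interval_length y z)%N.
Proof.
move=> le_xy; move: x y le_xy z.
apply: (@le_cover_ind (fun x y => forall z, y <= z -> interval_length x z =
          (interval_length x y + interval_length y z)%N)) => [x z le_xz|x y lt_xy].
  by rewrite interval_length_id.
move=> IH z le_yz; have [w cov le_wy] := covers_exists lt_xy.
rewrite (interval_length_rec cov le_wy) (interval_length_rec cov) //.
  by rewrite addSn -IH.
exact: le_trans le_yz.
Qed.

Lemma rank_add x y : x <= y -> rank y = (rank x + interval_length x y)%N.
Proof. by move=> le_xy; apply: interval_length_add => //; apply: le0x. Qed.

Lemma rank_bot : rank (\bot : T) = 0.
Proof. exact: interval_length_id. Qed.

Lemma rank_covers x w : covers x w -> rank w = (rank x).+1.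
Proof.
move=> cov; rewrite (@rank_add x w) ?ltW ?covers_lt //.
by rewrite (interval_length_rec cov (lexx w)) interval_length_id addn1.
Qed.

End Graded.

(** * Consequences of a function growing by one along covers, applied to [rank] and to
    [cube_rank] *)

Section RankFunction.
Variable r : T -> nat.
Hypothesis r_covers : forall x w, covers x w -> r w = (r x).+1.

Lemma rank_le x y : x <= y -> (r x <= r y)%N.
Proof.
move: x y; apply: le_cover_ind => // x y lt_xy IH.
have [w cov le_wy] := covers_exists lt_xy.
by apply: leq_trans (IH w cov le_wy); rewrite (r_covers cov).
Qed.

Lemma rank_lt x y : x < y -> (r x < r y)%N.
Proof.
move=> lt_xy; have [w cov le_wy] := covers_exists lt_xy.
by rewrite -(r_covers cov) rank_le.
Qed.

Lemma coversE x w : covers x w = (x < w) && (r w == (r x).+1).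
Proof.
apply/idP/andP => [cov | [lt_xw /eqP rw]].
  by rewrite (r_covers cov) eqxx (covers_lt cov).
have [z cov] := covers_exists lt_xw.
rewrite le_eqVlt => /orP[/eqP<-//|/rank_lt].
by rewrite rw (r_covers cov) ltnn.
Qed.

Lemma eq_rank_le x y : x <= y -> r x = r y -> x = y.
Proof.
rewrite le_eqVlt => /orP[/eqP//|/rank_lt lt_r eq_r].
by rewrite eq_r ltnn in lt_r.
Qed.

Lemma card_max_chain x y C : x <= y -> C \in max_chains x y ->
  #|C| = (r y - r x).+1.
Proof.
move=> le_xy; move: x y le_xy C.
apply: (@le_cover_ind (fun x y => forall C, C \in max_chains x y ->
   #|C| = (r y - r x).+1)) => [x C|x y lt_xy IH C CM].
  by rewrite max_chains_id => /set1P->; rewrite cards1 subnn.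
have [w [cov le_wy wC /(IH w cov le_wy) cardC]] := max_chain_cover lt_xy CM.
rewrite (cardsD1 x) (max_chain_bot (ltW lt_xy) CM) cardC (r_covers cov).
by rewrite add1n subnSK // rank_lt.
Qed.

Lemma graded_of_rank x y : x <= y -> graded_interval x y.
Proof.
move=> le_xy C E CM EM.
by rewrite /chain_length (card_max_chain le_xy CM) (card_max_chain le_xy EM).
Qed.

Lemma interval_length_of_rank x y : x <= y -> interval_length x y = (r y - r x)%N.
Proof.
move=> le_xy; have [C CM] := max_chain_exists x y.
rewrite (interval_length_card (graded_of_rank le_xy) CM).
by rewrite (card_max_chain le_xy CM).
Qed.

Definition level x y k : {set T} := [set z | (x <= z <= y) && (r z == k)].

Lemma levelP x y k z :
  reflect [/\ x <= z, z <= y & r z = k] (z \in level x y k).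
Proof.
rewrite inE -andbA; apply: (iffP and3P) => -[? ?].
  by move/eqP.
by move=> ->; rewrite eqxx.
Qed.

(** A maximal chain meets rank [k] in exactly one element and splits there into two maximal chains.
    The induction replaces [x] by its covers and exchanges the two sums. *)
Lemma card_max_chains_level x y k : x <= y -> (r x <= k <= r y)%N ->
  #|max_chains x y| =
    (\sum_(z in level x y k) #|max_chains x z| * #|max_chains z y|)%N.
Proof.
move: x y; apply: (@le_cover_ind (fun x y => (r x <= k <= r y)%N ->
  #|max_chains x y| =
    (\sum_(z in level x y k) #|max_chains x z| * #|max_chains z y|)%N)).
  move=> x; rewrite -eqn_leq => /eqP<-.
  rewrite (big_pred1 x) ?max_chains_id ?cards1 // => z /=.
  apply/levelP/eqP => [[le_xz le_zx _]|->]; last by [].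
  by apply/eqP; rewrite eq_le le_zx.
move=> x y lt_xy IH /andP[]; rewrite leq_eqVlt => /orP[/eqP<- _|lt_rk le_ky].
  rewrite (big_pred1 x) ?max_chains_id ?cards1 ?mul1n // => z /=.
  apply/levelP/eqP => [[le_xz _ eq_r]|->]; last by rewrite lexx ltW.
  exact/esym/eq_rank_le.
rewrite card_max_chains_rec //.
transitivity (\sum_(w | covers x w && (w <= y)%O) \sum_(z in level w y k)
  #|max_chains w z| * #|max_chains z y|)%N.
  apply: eq_bigr => w /andP[cov le_wy]; apply: IH => //.
  by rewrite (r_covers cov) lt_rk.
rewrite (exchange_big_dep (mem (level x y k))) /=; last first.
  move=> w z /andP[/covers_lt lt_xw _] /levelP[le_wz le_zy rz].
  by apply/levelP; split=> //; apply: le_trans (ltW lt_xw) _.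
apply: eq_bigr => z /levelP[le_xz le_zy rz]; rewrite -big_distrl /=.
rewrite (@card_max_chains_rec x z); last first.
  by rewrite lt_neqAle le_xz andbT; apply: contraTneq lt_rk => ->; rewrite rz ltnn.
congr (_ * _)%N; apply: eq_bigl => w; rewrite -andbA; congr (_ && _).
apply/andP/idP => [[_ /levelP[]]//|le_wz].
by rewrite (le_trans le_wz le_zy); split=> //; apply/levelP.
Qed.

(** An empty level would make the number of maximal chains zero. *)
Lemma level_exists x y k : x <= y -> (r x <= k <= r y)%N -> exists z, z \in level x y k.
Proof.
move=> le_xy k_in; case: (set_0Vmem (level x y k)) => [L0|[z]]; last by exists z.
have := card_max_chains_gt0 x y.
by rewrite (card_max_chains_level le_xy k_in) L0 big_set0.
Qed.

End RankFunction.
End MaximalChains.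

(** * The cubical lattice *)

Section CubeChains.
Local Open Scope order_scope.
Variable e : nat.
Implicit Types (f g h : {ffun 'I_e -> option bool}) (F G : cube_face e).

Local Notation face f := (Some f : cube_face e).
Local Notation vacant := (None : cube_face e).

Definition free_coords f : {set 'I_e} := [set i | f i == None].

Definition cube_rank F : nat := if F is Some f then #|free_coords f|.+1 else 0%N.

Definition free_at f i : {ffun 'I_e -> option bool} :=
  [ffun j => if j == i then None else f j].

Lemma cube_leP f g :
  reflect (forall i, g i = None \/ g i = f i)
    (face f <= face g).
Proof.
apply: (iffP forallP) => H i; first by have /orP[/eqP|/eqP] := H i; tauto.
by have [->|->] := H i; rewrite eqxx ?orbT.
Qed.

Lemma free_coords_sub f g :
  face f <= face g -> free_coords f \subset free_coords g.
Proof.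
move/cube_leP => H; apply/subsetP => i; rewrite !inE => /eqP fi.
by have [->|->] := H i; rewrite ?fi.
Qed.

Lemma cube_lt_free f g : face f < face g ->
  exists i, i \in free_coords g :\: free_coords f.
Proof.
rewrite lt_neqAle => /andP[ne_fg /cube_leP H]; apply/set0Pn; apply: contra ne_fg.
move/eqP=> D0; apply/eqP; congr Some; apply/ffunP => i.
have [gi|//] := H i; rewrite gi; have := in_set0 i; rewrite -D0 !inE gi andbT.
by move/negbT; rewrite negbK => /eqP.
Qed.

Lemma free_at_lt f i : i \notin free_coords f ->
  face f < face (free_at f i).
Proof.
rewrite inE => fi; rewrite lt_neqAle; apply/andP; split; last first.
  by apply/cube_leP => j; rewrite ffunE; case: ifP => _; [left | right].
by apply: contra fi => /eqP[/ffunP/(_ i)]; rewrite ffunE eqxx => ->.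
Qed.

Lemma free_at_le f g i : face f <= face g ->
  i \in free_coords g -> face (free_at f i) <= face g.
Proof.
move=> /cube_leP H; rewrite inE => /eqP gi; apply/cube_leP => j; rewrite ffunE.
by case: eqP => [->|_]; [left | apply: H].
Qed.

Lemma card_free_at f i : i \notin free_coords f ->
  #|free_coords (free_at f i)| = #|free_coords f|.+1.
Proof.
move=> fi; have -> : free_coords (free_at f i) = i |: free_coords f.
  by apply/setP => j; rewrite !inE ffunE; case: (j == i); rewrite ?eqxx.
by rewrite cardsU1 fi.
Qed.

Definition vertex_below g : {ffun 'I_e -> option bool} :=
  [ffun i => Some (odflt true (g i))].

Lemma cube_rank_covers F G : covers F G -> cube_rank G = (cube_rank F).+1.
Proof.
move=> /coversP[lt_FG cov].
(* As [G] covers [F], such a [w] must be [G]. It is found by freeing one coordinate of [F] or, if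
   [F] is the empty face, by taking a vertex of [G]. *)
suff [w lt_Fw [le_wG rw]] : exists2 w, F < w & w <= G /\ cube_rank w = (cube_rank F).+1.
  by move: le_wG; rewrite le_eqVlt (negPf (cov w lt_Fw)) orbF => /eqP<-.
case: F G lt_FG {cov} => [f|] [g|] //= lt_fg.
- have [i /setDP[gi fi]] := cube_lt_free lt_fg.
  exists (Some (free_at f i)); first exact: free_at_lt.
  by split; [apply: free_at_le => //; apply: ltW | rewrite /= card_free_at].
- exists (Some (vertex_below g)); first by rewrite lt_neqAle; apply/andP.
  split; last first.
    by congr _.+1; apply: eq_card0 => i; rewrite inE ffunE.
  by apply/cube_leP => i; rewrite ffunE; case: (g i) => [b|]; [right | left].
Qed.

(** The covers of [f] below [g] arise by freeing one coordinate that is fixed in [f] and free in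
    [g]. *)
Lemma card_covers_below f g : face f <= face g ->
  #|[set w : cube_face e | covers (face f) w && (w <= face g)]| =
  (#|free_coords g| - #|free_coords f|)%N.
Proof.
move=> le_fg; rewrite -(cardsDS (free_coords_sub le_fg)).
rewrite -(card_in_imset (f := fun i => face (free_at f i))).
  apply: eq_card => w; rewrite inE; apply/andP/imsetP.
    case=> /coversP[]; case: w => [h|] // lt_fh cov le_hg.
    have [i /setDP[hi fi]] := cube_lt_free lt_fh; exists i.
      by rewrite inE fi (subsetP (free_coords_sub le_hg)).
    have := free_at_le (ltW lt_fh) hi.
    by rewrite le_eqVlt (negPf (cov _ (free_at_lt fi))) orbF => /eqP.
  case=> i /setDP[gi fi] ->; split; last exact: free_at_le.
  by rewrite (coversE cube_rank_covers) free_at_lt //= card_free_at.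
move=> i j /setDP[_ fi] /setDP[_ fj] [/ffunP/(_ i)].
rewrite !ffunE eqxx; case: eqP => // _ /esym fi0.
by rewrite inE fi0 eqxx in fi.
Qed.

Lemma card_vertices_below g :
  #|[set w : cube_face e | covers vacant w && (w <= face g)]| = (2 ^ #|free_coords g|)%N.
Proof.
(* [V i] holds the values a vertex below [g] may take at [i]: both Booleans if [i] is free in [g],
   otherwise only the value of [g]. *)
pose V i : {pred option bool} :=
  [pred c | (c != None) && ((g i == None) || (g i == c))].
have -> : [set w : cube_face e | covers vacant w && (w <= face g)]
    = [set (face f) | f in family V].
  apply/setP => w; rewrite inE (coversE cube_rank_covers); apply/andP/imsetP.
    case=> /andP[_]; case: w => [f|] //= /eqP[f0] /cube_leP le_fg; exists f => //.
    apply/familyP => i; rewrite !inE; apply/andP; split.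
      by have := card0_eq f0 i; rewrite inE => ->.
    by have [->|->] := le_fg i; rewrite eqxx ?orbT.
  case=> f /familyP fV ->; split.
    rewrite lt_neqAle /=; apply/eqP; congr _.+1; apply: eq_card0 => i.
    by rewrite inE; have /andP[/negPf] := fV i.
  apply/cube_leP => i; have /andP[_ /orP[]/eqP] := fV i; tauto.
rewrite card_imset; last by move=> f h [].
rewrite card_family foldrE big_map big_enum /=.
rewrite (bigID (mem (free_coords g))) /= [X in (_ * X)%N]big1 ?muln1.
  rewrite -prod_nat_const; apply: eq_bigr => i; rewrite inE => gi.
  rewrite (cardD1 (Some true)) (cardD1 (Some false)) !inE gi /=.
  by rewrite eq_card0 // => -[[]|]; rewrite !inE.
move=> i; rewrite inE => gi; apply: (@eq_card1 _ (g i)) => c.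
rewrite !inE (negPf gi) /= andbC [c == _]eq_sym.
by case: eqP => // <-.
Qed.

(** Above a nonempty face the lattice is Boolean: the coordinates that remain can be freed in any
    order. *)
Lemma card_cube_max_chains F G : F <= G -> F != None ->
  #|max_chains F G| = (cube_rank G - cube_rank F)`!%N.
Proof.
move: F G; apply: (@le_cover_ind _ (cube_face e) (fun F G => F != None ->
   #|max_chains F G| = (cube_rank G - cube_rank F)`!%N)) => [F _|].
  by rewrite max_chains_id cards1 subnn.
move=> [f|] // [g|] // lt_fg IH _; rewrite card_max_chains_rec //.
have lt_r := rank_lt cube_rank_covers lt_fg.
rewrite (eq_bigr (fun=> (cube_rank (Some g) - cube_rank (Some f)).-1`!)%N).
  rewrite sum_nat_const -cardsE card_covers_below ?ltW //=.
  move: lt_r; rewrite -subn_gt0 /= subSS.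
  by case: (_ - _)%N => // k _; rewrite factS.
move=> w /andP[cov le_wg]; rewrite IH //.
  by rewrite (cube_rank_covers cov) subnS.
by case: w cov {le_wg} => // /covers_lt.
Qed.

Lemma card_cube_max_chains_bot g :
  #|max_chains vacant (Some g)| =
  (2 ^ #|free_coords g| * #|free_coords g|`!)%N.
Proof.
rewrite card_max_chains_rec //.
rewrite (eq_bigr (fun=> #|free_coords g|`!)%N).
  by rewrite sum_nat_const -cardsE card_vertices_below.
move=> w /andP[cov le_wg]; rewrite card_cube_max_chains //.
  by rewrite (cube_rank_covers cov) subSS subn0.
by case: w cov {le_wg} => // /covers_lt.
Qed.

Lemma cube_sheffer (D B : nat -> nat) :
  D 0%N = 1%N -> B 0%N = 1%N ->
  (forall k, (1 <= k <= e.+1)%N -> D k = 2 ^ (k - 1) * (k - 1)`!)%N ->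
  (forall k, (1 <= k <= e)%N -> B k = k`!)%N ->
  sheffer_poset (cube_face e) D B.
Proof.
move=> D0 B0 HD HB; have len := interval_length_of_rank cube_rank_covers.
have free_le f : (#|free_coords f| <= e)%N.
  by rewrite -[e in (_ <= e)%N]card_ord max_card.
split; first exact: (graded_of_rank cube_rank_covers).
  move=> [g|]; last by rewrite len // max_chains_id cards1.
  by rewrite len //= card_cube_max_chains_bot HD ?subn0 ?subn1 //= ltnS free_le.
move=> [f|] [g|] // _ le_fg; rewrite len // card_cube_max_chains //= subSS.
(* Length zero lies outside the range of [HB]. *)
have [->|k_gt0] := posnP (#|free_coords g| - #|free_coords f|)%N; first by rewrite B0.
rewrite HB // k_gt0.
exact: leq_trans (leq_subr _ _) (free_le g).
Qed.

End CubeChains.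

(** * Solving the Euler relations *)

(** Restricts the context to arithmetic over [nat] before [lia] or [nia] is called. *)
Ltac keep_arith := repeat match goal with
  | H : ?Q |- _ => lazymatch Q with
    | nat => fail
    | @eq ?A _ _ => tryif unify A nat then fail else clear H
    | is_true (negb (@eq_op ?A _ _)) =>
        tryif unify (Equality.sort A) nat then fail else clear H
    | is_true (leq _ _) => fail
    | is_true (andb (leq _ _) (leq _ _)) => fail
    | _ => clear H
    end
  end.
Ltac arith_lia := keep_arith; lia.
Ltac arith_nia := keep_arith; nia.

Lemma sum_D1_le (I : finType) (A : {set I}) (i : I) (F : I -> nat) (b : nat) :
  i \in A -> (forall j, j \in A -> j != i -> F j <= b) ->
  \sum_(j in A) F j <= F i + #|A|.-1 * b.
Proof.
move=> iA Fb; rewrite (big_setD1 i iA) leq_add2l /= [#|A|](cardsD1 i) iA add1n /=.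
by rewrite -sum_nat_const; apply: leq_sum => j /setD1P[ne_ji jA]; apply: Fb.
Qed.

(** For k > 0, the number of maximal chains in the face lattice of the cube of dimension k - 1. *)
Definition cubeD (k : nat) : nat := 2 ^ (k - 1) * (k - 1)`!.

(** * Euler relations of the Boolean and cubical lattices *)

Section Identities.
Local Open Scope ring_scope.

Lemma invr_fact_mul n i : (i <= n)%N ->
  (i`! * (n - i)`!)%:R^-1 = 'C(n, i)%:R / n`!%:R :> rat.
Proof.
move=> le_in; rewrite -(bin_fact le_in) [X in _ / X]natrM.
have nzC : 'C(n, i)%:R != 0 :> rat by rewrite pnatr_eq0 -lt0n bin_gt0.
by rewrite invfM mulrA divff // mul1r.
Qed.

(** The binomial expansion of (1 - 1)^n, divided by n!. *)
Lemma alternating_fact_sum n : (0 < n)%N ->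
  \sum_(0 <= i < n.+1) (-1) ^+ i / (i`! * (n - i)`!)%:R = 0 :> rat.
Proof.
move=> n_gt0; rewrite big_mkord.
have := exprDn (1 : rat) (-1) n; rewrite subrr expr0n eqn0Ngt n_gt0 mulr0n => /esym E.
rewrite -[RHS](mul0r n`!%:R^-1) -[X in _ = X * _]E mulr_suml; apply: eq_bigr => i _.
rewrite invr_fact_mul; last by rewrite -ltnS.
by rewrite expr1n mul1r mulrA mulr_natr.
Qed.

(** The binomial expansion of (1 - 1/2)^n, divided by n!. *)
Lemma alternating_cubeD_sum n :
  \sum_(0 <= i < n.+1) (-1) ^+ i / (cubeD i.+1 * (n.+1 - i.+1)`!)%:R =
  (cubeD n.+1)%:R^-1 :> rat.
Proof.
rewrite big_mkord.
have E := exprDn (1 : rat) (- 2%:R^-1) n.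
have -> : (cubeD n.+1)%:R^-1 = (1 - 2%:R^-1) ^+ n / n`!%:R :> rat.
  rewrite /cubeD subn1 natrM invfM natrX; congr (_ / _).
  by rewrite -exprVn; congr (_ ^+ _); field.
rewrite E mulr_suml; apply: eq_bigr => i _.
have le_in : (i <= n)%N by rewrite -ltnS.
rewrite subSS /cubeD subn1 /= -mulnA natrM invfM invr_fact_mul //.
rewrite expr1n mul1r [(- 2%:R^-1) ^+ i]exprNn natrX exprVn.
by rewrite !mulrA mulr_natr.
Qed.

End Identities.

Lemma sum_alternating_parity (I : finType) (A : {set I}) (f : I -> nat) :
  #|[set z in A | ~~ odd (f z)]| = #|[set z in A | odd (f z)]| ->
  (\sum_(z in A) (-1) ^+ f z = 0 :> rat)%R.
Proof.
move=> eq_eo; rewrite (bigID (fun z => odd (f z))) /=.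
rewrite (eq_bigr (fun=> - 1)%R); last first.
  by move=> z /andP[_ odd_z]; rewrite -signr_odd odd_z.
rewrite [X in (_ + X)%R](eq_bigr (fun=> 1)%R); last first.
  by move=> z /andP[_ /negPf odd_z]; rewrite -signr_odd odd_z.
rewrite !sumr_const mulNrn; apply/eqP; rewrite addrC subr_eq0; apply/eqP.
congr (_ *+ _)%R.
transitivity #|[set z in A | ~~ odd (f z)]|; last rewrite eq_eo.
  by apply: eq_card => z; rewrite !inE.
by apply: eq_card => z; rewrite !inE.
Qed.

(** * Unknown factorial values determined by the Euler relations *)

Section SolveEuler.
Local Open Scope ring_scope.
Variables D B : nat -> nat.

Lemma sum_split_ends (F : nat -> rat) n :
  \sum_(0 <= i < n.+2) F i = F 0%N + \sum_(0 <= i < n) F i.+1 + F n.+1.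
Proof. by rewrite big_nat_recr //= big_nat_recl. Qed.

(** For even n the two end terms are both +1 / B n and all other terms agree with those of the
    Boolean identity, so subtraction isolates 2 / B n. For odd n the end terms would cancel. *)
Lemma euler_solve_B n : ~~ odd n -> (0 < n)%N ->
  (forall j, (j < n)%N -> B j = j`!) ->
  \sum_(0 <= i < n.+1) (-1) ^+ i / (B i * B (n - i))%:R = 0 :> rat ->
  B n = n`!.
Proof.
move=> even_n n_gt0 HB; have := alternating_fact_sum n_gt0.
case: n even_n n_gt0 HB => // n even_n _ HB.
rewrite !sum_split_ends subn0 subnn -(signr_odd _ n.+1).
rewrite (negPf even_n) expr0 !mul1r HB // fact0 mul1n muln1.
set S := \sum_(0 <= i < n) _; set S' := \sum_(0 <= i < n) _.
have -> : S' = S.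
  by apply: eq_big_nat => i /andP[_ lt_i]; rewrite !HB //; lia.
rewrite mul1n muln1 => E1 E2.
apply/eqP; rewrite -(eqr_nat rat) -(inj_eq invr_inj); apply/eqP.
lra.
Qed.

(** For odd n the last term is -1 / D (n+1) and adds to the right side instead of cancelling it; all
    other terms agree with the cubical identity. *)
Lemma euler_solve_D n : odd n ->
  (forall j, (j <= n)%N -> B j = j`!) ->
  (forall j, (0 < j <= n)%N -> D j = cubeD j) ->
  \sum_(0 <= i < n.+1) (-1) ^+ i / (D i.+1 * B (n.+1 - i.+1))%:R =
    (D n.+1)%:R^-1 :> rat ->
  D n.+1 = cubeD n.+1.
Proof.
move=> odd_n HB HD; have := alternating_cubeD_sum n.
rewrite ![\sum_(0 <= i < n.+1) _]big_nat_recr //= subnn -signr_odd odd_n expr1.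
rewrite HB // fact0 !muln1.
set S := \sum_(0 <= i < n) _; set S' := \sum_(0 <= i < n) _.
have -> : S' = S.
  apply: eq_big_nat => i /andP[_ lt_i]; rewrite HD; last by lia.
  by rewrite HB //; lia.
move=> E1 E2; apply/eqP; rewrite -(eqr_nat rat) -(inj_eq invr_inj); apply/eqP.
lra.
Qed.

(** Subtracting the cubical identity leaves only the terms at i = 0, M and M + 1, which contain the
    three unknown values; the last of them merges with the right side, hence the factor 2. *)
Lemma euler_solve_D2 M : ~~ odd M -> (0 < M)%N ->
  (forall j, (j <= M)%N -> B j = j`!) ->
  (forall j, (0 < j <= M)%N -> D j = cubeD j) ->
  \sum_(0 <= i < M.+2) (-1) ^+ i / (D i.+1 * B (M.+2 - i.+1))%:R =
    (D M.+2)%:R^-1 :> rat ->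
  (B M.+1)%:R^-1 + (D M.+1)%:R^-1 - 2%:R * (D M.+2)%:R^-1 =
  (M.+1`!)%:R^-1 + (cubeD M.+1)%:R^-1 - 2%:R * (cubeD M.+2)%:R^-1 :> rat.
Proof.
move=> even_M M_gt0 HB HD; have := alternating_cubeD_sum M.+1.
case: M even_M M_gt0 HB HD => // M even_M _ HB HD.
rewrite !(sum_split_ends _ M.+1) ![\sum_(0 <= i < M.+1) _]big_nat_recr //=.
have s1 : (-1) ^+ M.+1 = 1 :> rat by rewrite -signr_odd (negPf even_M).
have s2 : (-1) ^+ M.+2 = -1 :> rat by rewrite exprS s1 mulr1.
rewrite s1 s2 expr0 subnn subSnn subn1 /= (HB 0%N) // (HB 1%N) // (HD 1%N) //.
rewrite (_ : cubeD 1 = 1%N) // fact0 (_ : 1`! = 1%N) // !muln1 !mul1n.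
set S := \sum_(0 <= i < M) _; set S' := \sum_(0 <= i < M) _.
have -> : S' = S.
  apply: eq_big_nat => i /andP[_ lt_i]; rewrite HD; last by lia.
  by rewrite HB //; lia.
move=> E1 E2; lra.
Qed.

(* The equation of [euler_solve_D2] for B M.+1 = a * M`!, D M.+1 = c * D M and
   D M.+2 = C * D M.+1, with denominators cleared. *)
Lemma euler_nat_relation M a c C : (0 < M)%N -> (0 < a)%N -> (0 < c)%N -> (0 < C)%N ->
  (a * M`!)%:R^-1 + (c * cubeD M)%:R^-1 - 2%:R * (C * (c * cubeD M))%:R^-1 =
  (M.+1`!)%:R^-1 + (cubeD M.+1)%:R^-1 - 2%:R * (cubeD M.+2)%:R^-1 :> rat ->
  (2 * 2 ^ (M - 1) * M.+1 * c * C + 2 * M * M.+1 * a * C =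
   4 * M * M.+1 * a + 2 * 2 ^ (M - 1) * a * c * C + M * a * c * C)%N.
Proof.
move=> M_gt0 a_gt0 c_gt0 C_gt0; pose f := (M - 1)`!.
have fE : M`! = (M * f)%N by rewrite /f subn1 -{1 2}(prednK M_gt0) factS.
have qE : (2 ^ M = 2 * 2 ^ (M - 1))%N by rewrite -expnS; congr (_ ^ _)%N; lia.
rewrite /cubeD -/f !subSS !subn0 expnS factS fE qE; set q := (2 ^ (M - 1))%N.
have q_gt0 : (0 < q)%N by rewrite expn_gt0.
have f_gt0 : (0 < f)%N by rewrite fact_gt0.
move=> E; apply/eqP; rewrite -(eqr_nat rat); move: E.
have nz k : (0 < k)%N -> k%:R != 0 :> rat by rewrite pnatr_eq0 -lt0n.
have nzM1 := nz M.+1 isT.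
move: (nz _ M_gt0) nzM1 (nz _ q_gt0) (nz _ f_gt0) (nz _ a_gt0) (nz _ c_gt0) (nz _ C_gt0).
rewrite -[M.+1]addn1 !natrD !natrM !natrD.
move: M%:R q%:R f%:R a%:R c%:R C%:R => m' q' f' a' c' C' nzm nzm1.
move=> nzq nzf nza nzc nzC E; rewrite -subr_eq0; apply/eqP.
(* The difference of the two sides is this multiple of the difference in the rational equation. *)
rewrite -(mulr0 (2%:R * m' * (m' + 1) * a' * c' * C' * q' * f')).
move/eqP: E; rewrite -subr_eq0 => /eqP E; rewrite -[X in _ = _ * X]E.
by field; rewrite nzm nzm1 nzq nzf nza nzc nzC.
Qed.

End SolveEuler.

(** * Integer solutions of the relation at rank M + 2 *)

(** If a >= 2M, the two terms with C on the right already reach the left side, and the positive term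
    4M(M+1)a breaks the equality. *)
Lemma nat_relation_a_lt M q a c C : 3 < M -> M.*2 <= q -> M <= c -> 0 < a ->
  2 * q * M.+1 * c * C + 2 * M * M.+1 * a * C =
  4 * M * M.+1 * a + 2 * q * a * c * C + M * a * c * C -> a < M.*2.
Proof.
move=> M_gt3 le_q le_c a_gt0 E; rewrite ltnNge; apply/negP => le_a.
have [b aE] : exists b, a = b + M.+1 by exists (a - M.+1); lia.
(* Here b >= M - 1 and 2q >= 4M. At b = M - 1 the bound amounts to 2M^2 >= 8M, which is sharp at M =
   4. *)
have H1 : M.+2 * a <= 2 * q * b.
  have : 4 * M * b <= 2 * q * b by rewrite leq_mul2r; lia.
  apply: leq_trans.
  have [m ME] : exists m, M = m + 4 by exists (M - 4); lia.
  have [t bE] : exists t, b = m + 3 + t by exists (b - (m + 3)); lia.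
  rewrite aE bE ME; clear; nia.
(* After cancelling 2q(M+1)c, the term 2M(M+1)a is split as M(M+2)a + M^2 a and the parts are
   bounded separately, using c >= M. *)
have H2 : 2 * q * M.+1 * c + 2 * M * M.+1 * a <= 2 * q * a * c + M * a * c.
  have : M * (M.+2 * a) <= c * (2 * q * b) by apply: leq_mul.
  have : M * (M * a) <= c * (M * a) by apply: leq_mul.
  rewrite aE; clear; lia.
have H3 : (2 * q * M.+1 * c + 2 * M * M.+1 * a) * C <= (2 * q * a * c + M * a * c) * C.
  by apply: leq_mul.
have H4 : 0 < M * M.+1 * a by rewrite !muln_gt0 a_gt0; lia.
by move: E H3 H4; clear; lia.
Qed.

(** For a = M + 1 the relation reads eC = 4(M+1) with e = 2(M+1) - c, and C >= M + 1 gives 1 <= e <=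
    4. The case e = 1 is the excluded c and e = 2 is the answer; e = 3 and e = 4 give c < 2M but c
    >= C. *)
Lemma nat_relation_solve M q c C : 3 < M -> M.+1 <= C ->
  (c < M.*2 -> c < C) -> c != M.*2.+1 ->
  2 * q * M.+1 * c * C + 2 * M * M.+1 * M.+1 * C =
  4 * M * M.+1 * M.+1 + 2 * q * M.+1 * c * C + M * M.+1 * c * C ->
  c = M.*2 /\ C = M.+1.*2.
Proof.
move=> M_gt3 le_C lt_c neq_c E.
have E2 : 2 * M.+1 * C = 4 * M.+1 + c * C.
  apply/eqP; rewrite -(@eqn_pmul2l (M * M.+1)) ?muln_gt0; last by lia.
  by apply/eqP; nia.
have lt2 : c < 2 * M.+1.
  rewrite ltnNge; apply/negP => le2.
  have : 2 * M.+1 * C <= c * C by apply: leq_mul.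
  by lia.
pose e := 2 * M.+1 - c; have c_eq : c = 2 * M.+1 - e by lia.
have eC : e * C = 4 * M.+1 by rewrite mulnBl; lia.
have e_le4 : e <= 4.
  rewrite leqNgt; apply/negP => e_gt4.
  have : 5 * M.+1 <= e * C by apply: leq_mul.
  by lia.
have e_gt0 : 0 < e by lia.
move: eC lt_c neq_c; rewrite c_eq; move: e e_le4 e_gt0 {c_eq} => e.
by case: e => [|[|[|[|[|e]]]]] // _ _; lia.
Qed.

Lemma double_leq_expn M : 3 < M -> M.*2 <= 2 ^ (M - 1).
Proof.
case: M => // M; rewrite subn1 /=; elim: M => // M IH; rewrite ltnS leq_eqVlt.
case/orP=> [/eqP<-//|M_gt]; have := IH M_gt; rewrite expnS; lia.
Qed.

(** * Eulerian Sheffer posets *)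

Lemma cubeDS k : 0 < k -> cubeD k.+1 = k.*2 * cubeD k.
Proof.
case: k => // k _; rewrite /cubeD !subSS !subn0 expnS factS.
by move: (2 ^ k) k`! => u v; lia.
Qed.

Section EulerianSheffer.
Context {d : Order.disp_t} {T : finTBPOrderType d}.
Variables (r : T -> nat) (D B : nat -> nat).
Hypothesis r_covers : forall x w : T, covers x w -> r w = (r x).+1.
Hypothesis r_bot : r \bot%O = 0.
Hypothesis chainsD : forall y : T, #|max_chains \bot%O y| = D (r y).
Hypothesis chainsB : forall x y : T, x != \bot%O -> (x <= y)%O ->
  #|max_chains x y| = B (r y - r x).
Hypothesis eulerian_r : forall x y : T, (x < y)%O ->
  #|[set z in poset_interval x y | ~~ odd (r z)]| =
  #|[set z in poset_interval x y | odd (r z)]|.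
Implicit Types x y z v w s t : T.

Local Notation level := (level r).

Lemma level_B x y k : x != \bot%O -> (x <= y)%O -> r x <= k <= r y ->
  B (r y - r x) = #|level x y k| * (B (k - r x) * B (r y - k)).
Proof.
move=> x0 le_xy k_in.
rewrite -chainsB // (card_max_chains_level r_covers le_xy k_in).
rewrite -sum_nat_const; apply: eq_bigr => z /levelP[le_xz le_zy <-].
rewrite !chainsB //; apply: contraNneq x0 => z0.
by rewrite -lex0 -z0.
Qed.

(** The condition [0 < k] keeps the elements of the level away from the minimum, so that the
    intervals above them are counted by [B]. *)
Lemma level_D y k : 0 < k <= r y ->
  D (r y) = #|level \bot%O y k| * (D k * B (r y - k)).
Proof.
case/andP=> k_gt0 le_ky.
have k_in : r \bot%O <= k <= r y by rewrite r_bot.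
rewrite -chainsD (card_max_chains_level r_covers (le0x y) k_in).
rewrite -sum_nat_const; apply: eq_bigr => z /levelP[_ le_zy rz].
rewrite chainsD chainsB // -?rz //; apply: contraTneq k_gt0 => z0.
by rewrite -rz z0 r_bot.
Qed.

(** * Atoms, coatoms and ridges of intervals *)

Definition atoms x y : {set T} := level x y (r x).+1.
Definition coatoms x y : {set T} := level x y (r y).-1.
Definition ridges x y s s' : {set T} :=
  [set t in level x y (r y).-2 | (t <= s)%O && (t <= s')%O].

(** Both sides count the pairs of an atom below [s] and a coatom above that atom. *)
Lemma sum_common_atoms x y s : s \in coatoms x y ->
  \sum_(s' in coatoms x y) #|atoms x s :&: atoms x s'| =
  \sum_(v in atoms x s) #|coatoms v y|.
Proof.
move=> /levelP[le_xs le_sy rs].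
under eq_bigr do rewrite -sum1_card.
rewrite (exchange_big_dep (mem (atoms x s))) /=; last by move=> ? v _ /setIP[].
apply: eq_bigr => v vs; rewrite -sum1_card; apply: eq_bigl => s'.
have /levelP[le_xv le_vs rv] := vs.
rewrite in_setI vs /=; apply/andP/levelP => [[/levelP[_ ? ?] /levelP[_ ? _]]//|].
case=> le_vs' le_s'y rs'; split; apply/levelP; split=> //.
exact: le_trans le_vs'.
Qed.

(** Counts the pairs of a common atom and a common ridge above it: each common atom lies below
    exactly one such ridge, and each ridge lies above [h] atoms. *)
Lemma card_common_atoms x y s s' h :
  (forall v, v \in atoms x s -> v \in atoms x s' -> #|ridges v y s s'| = 1) ->
  (forall t, t \in level x y (r y).-2 -> #|atoms x t| = h) ->
  #|atoms x s :&: atoms x s'| = #|ridges x y s s'| * h.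
Proof.
move=> uniq_ridge Hh; rewrite -sum1_card.
transitivity (\sum_(v in atoms x s :&: atoms x s') \sum_(t in ridges v y s s') 1).
  apply: eq_bigr => v /setIP[vs vs']; rewrite sum1_card uniq_ridge //.
rewrite (exchange_big_dep (mem (ridges x y s s'))) /=; last first.
  move=> v t /setIP[/levelP[le_xv _ _] _]; rewrite !inE.
  case/andP=> /andP[/andP[le_vt ->] ->] ->.
  by rewrite (le_trans le_xv le_vt).
rewrite -sum_nat_const; apply: eq_bigr => t; rewrite inE => /and3P[tL le_ts le_ts'].
rewrite -(Hh t tL) sum1dep_card; apply: eq_card => v.
rewrite !inE -!andbA le_ts le_ts' /=.
have [_ le_ty rt] := levelP _ _ _ _ _ tL; rewrite le_ty rt eqxx /=.
case le_xv : (x <= v)%O => //=; case le_vt : (v <= t)%O => /=; last by rewrite !andbF.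
by rewrite !andbT (le_trans le_vt le_ts) (le_trans le_vt le_ts') /= andbb.
Qed.

Lemma atoms_neq0 x y v : v \in atoms x y -> v != \bot%O.
Proof. by case/levelP=> _ _ rv; apply/eqP => v0; rewrite v0 r_bot in rv. Qed.

Lemma atomsS x y z : (y <= z)%O -> atoms x y \subset atoms x z.
Proof.
move=> le_yz; apply/subsetP => v /levelP[? le_vy ?]; apply/levelP; split=> //.
exact: le_trans le_yz.
Qed.

Lemma coatom_exists x y : r x < r y -> (x <= y)%O -> exists s, s \in coatoms x y.
Proof. by move=> lt_r le_xy; apply: (level_exists r_covers) => //; arith_lia. Qed.

Lemma card_atoms_B k x y : (forall j, j <= k -> B j = j`!) -> x != \bot%O ->
  (x <= y)%O -> r y = r x + k -> 0 < k -> #|atoms x y| = k.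
Proof.
move=> HB x0 le_xy ry k_gt0.
have k_in : r x <= (r x).+1 <= r y by arith_lia.
have := level_B x0 le_xy k_in; rewrite -/(atoms x y).
have -> : r y - r x = k by arith_lia.
have -> : (r x).+1 - r x = 1 by arith_lia.
have -> : r y - (r x).+1 = k.-1 by arith_lia.
rewrite !HB; try arith_lia.
rewrite -{1}(prednK k_gt0) factS prednK // mul1n => /eqP.
by rewrite eqn_pmul2r ?fact_gt0 // => /eqP.
Qed.

Lemma card_coatoms_B k x y : (forall j, j <= k -> B j = j`!) -> x != \bot%O ->
  (x <= y)%O -> r y = r x + k -> 0 < k -> #|coatoms x y| = k.
Proof.
move=> HB x0 le_xy ry k_gt0.
have k_in : r x <= (r y).-1 <= r y by arith_lia.
have := level_B x0 le_xy k_in; rewrite -/(coatoms x y).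
have -> : r y - r x = k by arith_lia.
have -> : (r y).-1 - r x = k.-1 by arith_lia.
have -> : r y - (r y).-1 = 1 by arith_lia.
rewrite !HB; try arith_lia.
rewrite -{1}(prednK k_gt0) factS prednK // muln1 => /eqP.
by rewrite eqn_pmul2r ?fact_gt0 // => /eqP.
Qed.

(** Induction on the length. In length k + 1, the induction hypothesis above each common atom makes
    the number of common atoms k - 1 times the number of ridges. Each coatom has k of the k + 1
    atoms, so at least k - 1 are common, and fewer than k are; this leaves one ridge. *)
Lemma card_ridges_B k x y s s' : (forall j, j <= k -> B j = j`!) -> 1 < k ->
  x != \bot%O -> (x <= y)%O -> r y = r x + k ->
  s \in coatoms x y -> s' \in coatoms x y -> s != s' -> #|ridges x y s s'| = 1.
Proof.
elim: k x s s' => // k IH x s s' HB k_gt1 x0 le_xy ry sK s'K ne_ss'.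
have [le_xs le_sy rs] := levelP _ _ _ _ _ sK.
have [le_xs' le_s'y rs'] := levelP _ _ _ _ _ s'K.
have [k1|k_neq1] := eqVneq k 1.
  (* In length two the only ridge is [x] itself. *)
  apply: (@eq_card1 _ x) => t; rewrite !inE; apply/idP/eqP => [|->].
    case/and3P=> /andP[/andP[le_xt le_ty] /eqP rt] _ _.
    by apply/esym/(eq_rank_le r_covers le_xt); arith_lia.
  by rewrite lexx le_xy le_xs le_xs' /= andbT; apply/eqP; arith_lia.
have HB' j : j <= k -> B j = j`! by move=> le_jk; apply: HB; arith_lia.
have card_s : #|atoms x s| = k by apply: card_atoms_B => //; arith_lia.
have card_s' : #|atoms x s'| = k by apply: card_atoms_B => //; arith_lia.
have card_y : #|atoms x y| = k.+1 by apply: card_atoms_B => //; arith_lia.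
have lower : k.-1 <= #|atoms x s :&: atoms x s'|.
  have : #|atoms x s :|: atoms x s'| <= k.+1.
    by rewrite -card_y subset_leq_card // subUset !atomsS.
  by rewrite cardsU card_s card_s'; arith_lia.
(* Were the atoms of s and s' the same, an atom below neither would be covered
   by too few coatoms. *)
have upper : #|atoms x s :&: atoms x s'| < k.
  rewrite ltnNge; apply/negP => le_k.
  have eq_s : atoms x s :&: atoms x s' = atoms x s.
    by apply/eqP; rewrite eqEcard subsetIl card_s.
  have eq_s' : atoms x s :&: atoms x s' = atoms x s'.
    by apply/eqP; rewrite eqEcard subsetIr card_s'.
  have /properP[_ [w wy ws]] : atoms x s \proper atoms x y.
    by rewrite properEcard atomsS // card_s card_y ltnSn.
  have ws' : w \notin atoms x s' by rewrite -eq_s' eq_s.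
  have [le_xw le_wy rw] := levelP _ _ _ _ _ wy.
  have card_w : #|coatoms w y| = k.
    by apply: card_coatoms_B => //; [apply: atoms_neq0 wy | arith_lia].
  have card_x : #|coatoms x y| = k.+1 by apply: card_coatoms_B.
  have sub : coatoms w y \subset coatoms x y :\ s :\ s'.
    apply/subsetP => t /levelP[le_wt le_ty rt]; rewrite !inE.
    rewrite (le_trans le_xw le_wt) le_ty rt eqxx !andbT.
    apply/andP; split; apply/eqP => eq_t; subst t.
      by case/negP: ws'; apply/levelP.
    by case/negP: ws; apply/levelP.
  have := subset_leq_card sub; rewrite card_w.
  have := cardsD1 s (coatoms x y); rewrite sK card_x.
  have := cardsD1 s' (coatoms x y :\ s); rewrite in_setD1 eq_sym ne_ss' s'K /=.
  by arith_lia.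
suff eq_card : #|atoms x s :&: atoms x s'| = #|ridges x y s s'| * k.-1 by arith_nia.
apply: card_common_atoms.
- move=> v vs vs'; have [le_xv le_vs rv] := levelP _ _ _ _ _ vs.
  have [_ le_vs' _] := levelP _ _ _ _ _ vs'.
  have le_vy := le_trans le_vs le_sy.
  apply: IH => //; try arith_lia; first exact: atoms_neq0 vs.
  + exact/levelP.
  + exact/levelP.
- move=> t /levelP[le_xt le_ty rt]; apply: card_atoms_B => //; try arith_lia.
  by move=> j le_jk; apply: HB; arith_lia.
Qed.

(** Once [B 1] is known to be 1, the ratio of consecutive values of [B], and likewise of [D], is a
    number of coatoms and hence an integer. *)
Lemma card_level_coatoms_B k x y : x != \bot%O -> (x <= y)%O -> r y = r x + k.+1 ->
  B k.+1 = #|coatoms x y| * (B k * B 1).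
Proof.
move=> x0 le_xy ry; have k_in : r x <= (r y).-1 <= r y by arith_lia.
have := level_B x0 le_xy k_in; rewrite -/(coatoms x y).
have -> : r y - r x = k.+1 by arith_lia.
have -> : (r y).-1 - r x = k by arith_lia.
by have -> : r y - (r y).-1 = 1 by arith_lia.
Qed.

Lemma card_level_atoms_B k x y : x != \bot%O -> (x <= y)%O -> r y = r x + k.+1 ->
  B k.+1 = #|atoms x y| * (B 1 * B k).
Proof.
move=> x0 le_xy ry; have k_in : r x <= (r x).+1 <= r y by arith_lia.
have := level_B x0 le_xy k_in; rewrite -/(atoms x y).
have -> : r y - r x = k.+1 by arith_lia.
have -> : (r x).+1 - r x = 1 by arith_lia.
by have -> : r y - (r x).+1 = k by arith_lia.
Qed.

Lemma card_level_coatoms_D k y : 0 < k -> r y = k.+1 ->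
  D k.+1 = #|coatoms \bot%O y| * (D k * B 1).
Proof.
move=> k_gt0 ry; have k_in : 0 < (r y).-1 <= r y by arith_lia.
have := level_D k_in; rewrite -/(coatoms _ y).
have -> : r y - (r y).-1 = 1 by arith_lia.
by rewrite ry.
Qed.

Lemma card_level_atoms_D k y : r y = k.+1 ->
  D k.+1 = #|atoms \bot%O y| * (D 1 * B k).
Proof.
move=> ry; have k_in : 0 < (r \bot%O).+1 <= r y by rewrite r_bot; arith_lia.
have := level_D k_in; rewrite -/(atoms _ y) r_bot.
by rewrite ry subn1.
Qed.

(** * Restrictions on the next ratios when the values up to M are known *)

Section BooleanBelow.
Variable M : nat.
Hypothesis M_gt2 : 2 < M.
Hypothesis B_fact : forall j, j <= M -> B j = j`!.

(** Any two coatoms have M of the a < 2M atoms each, so they share some; the number shared is a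
    multiple of M - 1 and at most M, hence M - 1. Summing over the coatoms gives M + (a - 1)(M - 1)
    = M^2. *)
Lemma B_ratio_eq a x y : x != \bot%O -> (x <= y)%O -> r y = r x + M.+1 ->
  B M.+1 = a * M`! -> a < M.*2 -> a = M.+1.
Proof.
move=> x0 le_xy ry Ba a_lt.
have cardK : #|coatoms x y| = a.
  have := card_level_coatoms_B x0 le_xy ry; rewrite Ba !B_fact; try arith_lia.
  by move/eqP; rewrite muln1 eqn_pmul2r ?fact_gt0 // => /eqP.
have cardA : #|atoms x y| = a.
  have := card_level_atoms_B x0 le_xy ry; rewrite Ba !B_fact; try arith_lia.
  by move/eqP; rewrite mul1n eqn_pmul2r ?fact_gt0 // => /eqP.
have [|//|s sK] := @coatom_exists x y; first by arith_lia.
have card_coatom t : t \in coatoms x y -> #|atoms x t| = M.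
  by move=> /levelP[? ? ?]; apply: card_atoms_B => //; arith_lia.
have common t : t \in coatoms x y -> t != s -> #|atoms x s :&: atoms x t| = M.-1.
  move=> tK ne_ts; have [le_xs le_sy rs] := levelP _ _ _ _ _ sK.
  have [le_xt le_ty rt] := levelP _ _ _ _ _ tK.
  have eq_card : #|atoms x s :&: atoms x t| = #|ridges x y s t| * M.-1.
    apply: card_common_atoms => [v vs vt|z /levelP[le_xz le_zy rz]]; last first.
      apply: card_atoms_B => //; try arith_lia.
      by move=> j le_j; apply: B_fact; arith_lia.
    have [le_xv le_vs rv] := levelP _ _ _ _ _ vs.
    have [_ le_vt _] := levelP _ _ _ _ _ vt.
    apply: (@card_ridges_B M) => //; try arith_lia.
    - exact: atoms_neq0 vs.
    - exact: le_trans le_vs le_sy.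
    - exact/levelP.
    - exact/levelP.
    - by rewrite eq_sym.
  have : #|atoms x s :&: atoms x t| <= M.
    by rewrite -(card_coatom s sK) subset_leq_card ?subsetIl.
  have : #|atoms x s :|: atoms x t| <= a.
    by rewrite -cardA subset_leq_card // subUset !atomsS.
  rewrite cardsU !card_coatom //; move: eq_card.
  (* No ridge would need 2M atoms; two ridges would give 2(M - 1) > M common atoms. *)
  by case: #|ridges x y s t| => [|[|q]]; rewrite ?mulSn; [| |move: (q * _) => k];
     move=> eq_card; arith_lia.
have sumE : \sum_(t in coatoms x y) #|atoms x s :&: atoms x t| = M * M.
  rewrite sum_common_atoms // -{1}(card_coatom s sK) -sum_nat_const.
  have [le_xs le_sy rs] := levelP _ _ _ _ _ sK.
  apply: eq_bigr => v vs; have [le_xv le_vs rv] := levelP _ _ _ _ _ vs.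
  apply: card_coatoms_B => //; try arith_lia; first exact: atoms_neq0 vs.
  exact: le_trans le_vs le_sy.
have : \sum_(t in coatoms x y :\ s) #|atoms x s :&: atoms x t| = (a - 1) * M.-1.
  rewrite -cardK [#|coatoms x y|](cardsD1 s) sK addKn -sum_nat_const.
  by apply: eq_bigr => t /setD1P[ne_ts tK]; apply: common.
move: sumE; rewrite (big_setD1 s sK) /= setIid card_coatom //.
by arith_nia.
Qed.

Hypothesis D_cube : forall k, 0 < k <= M -> D k = 2 ^ (k - 1) * (k - 1)`!.

Lemma card_atoms_D k y : 0 < k <= M -> r y = k -> #|atoms \bot%O y| = 2 ^ (k - 1).
Proof.
case: k => // k k_in ry; have := card_level_atoms_D ry.
rewrite !D_cube ?B_fact; try arith_lia.
rewrite !subn1 /= expn0 mul1n => /eqP.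
by rewrite mul1n eqn_pmul2r ?fact_gt0 // => /eqP.
Qed.

(** Kept as a product to avoid the quotient c 2^(M-1) / M. *)
Lemma card_atoms_DS c y : r y = M.+1 -> D M.+1 = c * D M ->
  #|atoms \bot%O y| * M = c * 2 ^ (M - 1).
Proof.
move=> ry Dc; have := card_level_atoms_D ry; rewrite Dc !D_cube ?B_fact; try arith_lia.
have -> : M`! = M * (M - 1)`! by case: M M_gt2 => // k _; rewrite subn1 factS.
rewrite subnn expn0 !mul1n !mulnA => /eqP.
by rewrite eqn_pmul2r ?fact_gt0 // => /eqP.
Qed.

(** Write q = 2^(M-1) for the number of atoms below a ridge and V for that below a coatom, so VM =
    cq. As c < 2M, V < 2q, so two coatoms share at most one ridge and at most q atoms. Counting
    common atoms gives V(M+1) <= V + (C - 1)q, that is, c <= C - 1. *)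
Lemma cube_coatoms_lt c C y : r y = M.+2 -> B M.+1 = M.+1`! ->
  D M.+1 = c * D M -> D M.+2 = C * D M.+1 -> 0 < c -> c < M.*2 -> c < C.
Proof.
move=> ry BS Dc DC c_gt0 c_lt.
have BS_fact j : j <= M.+1 -> B j = j`!.
  by rewrite leq_eqVlt => /orP[/eqP->|/B_fact].
have DM_gt0 : 0 < D M.
  by rewrite D_cube ?muln_gt0 ?expn_gt0 ?fact_gt0 //; arith_lia.
have cardK : #|coatoms \bot%O y| = C.
  have := card_level_coatoms_D (ltn0Sn M) ry; rewrite DC B_fact ?muln1; last by arith_lia.
  by move/eqP; rewrite eqn_pmul2r ?Dc ?muln_gt0 ?c_gt0 // => /eqP.
have [||s sK] := @coatom_exists \bot%O y; rewrite ?r_bot ?ry ?le0x //.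
have [_ le_sy rs] := levelP _ _ _ _ _ sK; rewrite ry /= in rs.
have Vs := card_atoms_DS rs Dc.
have q_gt0 : 0 < 2 ^ (M - 1) by rewrite expn_gt0.
have common t : t \in coatoms \bot%O y -> t != s ->
    #|atoms \bot%O s :&: atoms \bot%O t| <= 2 ^ (M - 1).
  move=> tK ne_ts.
  have [_ le_ty rt] := levelP _ _ _ _ _ tK.
  have eq_card : #|atoms \bot%O s :&: atoms \bot%O t|
      = #|ridges \bot%O y s t| * 2 ^ (M - 1).
    apply: card_common_atoms => [v vs vt|z /levelP[_ le_zy rz]]; last first.
      by apply: card_atoms_D; arith_lia.
    have [_ le_vs rv] := levelP _ _ _ _ _ vs; rewrite r_bot in rv.
    have [_ le_vt _] := levelP _ _ _ _ _ vt.
    apply: (@card_ridges_B M.+1) => //; try arith_lia.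
    - exact: atoms_neq0 vs.
    - exact: le_trans le_vs le_sy.
    - by apply/levelP; rewrite ry.
    - exact/levelP.
    - by rewrite eq_sym.
  have : #|atoms \bot%O s :&: atoms \bot%O t| <= #|atoms \bot%O s|.
    by rewrite subset_leq_card ?subsetIl.
  have : c * 2 ^ (M - 1) < M.*2 * 2 ^ (M - 1) by rewrite ltn_pmul2r.
  have : #|ridges \bot%O y s t| <= 1 \/ 2 <= #|ridges \bot%O y s t| by arith_lia.
  by move: eq_card Vs => ->; case; arith_nia.
have := sum_D1_le sK common; rewrite setIid cardK sum_common_atoms //.
rewrite (eq_bigr (fun=> M.+1)); last first.
  move=> v vs; have [_ le_vs rv] := levelP _ _ _ _ _ vs; rewrite r_bot in rv.
  apply: card_coatoms_B => //; try arith_lia; first exact: atoms_neq0 vs.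
  exact: le_trans le_vs le_sy.
rewrite sum_nat_const mulnS leq_add2l Vs leq_pmul2r //.
by arith_lia.
Qed.

Lemma card_coatoms_D c y : r y = M.+1 -> D M.+1 = c * D M -> #|coatoms \bot%O y| = c.
Proof.
move=> ry Dc; have M_gt0 : 0 < M by arith_lia.
have := card_level_coatoms_D M_gt0 ry.
rewrite Dc B_fact // muln1 D_cube; last by arith_lia.
by move/eqP; rewrite eqn_pmul2r ?muln_gt0 ?expn_gt0 ?fact_gt0 // => /eqP.
Qed.

(* Two coatoms disjoint from s have the same atoms, so passing from s to a coatom
   disjoint from s exchanges [opp] and [same]. *)
Lemma cube_coatoms_neq c y : r y = M.+1 -> D M.+1 = c * D M -> c != M.*2.+1.
Proof.
move=> ry Dc; apply/eqP => c_eq; have cardK := card_coatoms_D ry Dc.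
(* There are h atoms below a ridge of [y] and 2h below a coatom, so two coatoms share 0, h or 2h
   atoms. *)
pose h := 2 ^ (M - 2); have h_gt0 : 0 < h by rewrite expn_gt0.
have q_eq : 2 ^ (M - 1) = h.*2.
  by rewrite -mul2n -expnS; congr (2 ^ _); arith_lia.
have VE := card_atoms_DS ry Dc; rewrite q_eq in VE.
set V := #|atoms _ y| in VE.
pose K := coatoms \bot%O y; pose At s := atoms \bot%O s.
have cardAt s : s \in K -> #|At s| = h.*2.
  case/levelP=> _ _ rs; rewrite -q_eq; apply: card_atoms_D => //.
    by arith_lia.
  by rewrite rs ry.
have sAt s : s \in K -> At s \subset At y by case/levelP=> _ le_sy _; apply: atomsS.
have common s t : s \in K -> t \in K ->
    [\/ #|At s :&: At t| = 0, #|At s :&: At t| = h | #|At s :&: At t| = h.*2].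
  move=> sK tK; have [->|ne_st] := eqVneq s t.
    by rewrite setIid cardAt //; constructor 3.
  have [_ le_sy rs] := levelP _ _ _ _ _ sK; have [_ le_ty rt] := levelP _ _ _ _ _ tK.
  have eq_card : #|At s :&: At t| = #|ridges \bot%O y s t| * h.
    apply: card_common_atoms => [v vs vt|z /levelP[_ le_zy rz]]; last first.
      rewrite /h (@card_atoms_D (M - 1)); try arith_lia.
      by congr (2 ^ _); arith_lia.
    have [_ le_vs rv] := levelP _ _ _ _ _ vs; rewrite r_bot in rv.
    have [_ le_vt _] := levelP _ _ _ _ _ vt.
    apply: (@card_ridges_B M) => //; try arith_lia.
    - exact: atoms_neq0 vs.
    - exact: le_trans le_vs le_sy.
    - exact/levelP.
    - exact/levelP.
  have : #|At s :&: At t| <= h.*2 by rewrite -(cardAt s sK) subset_leq_card ?subsetIl.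
  rewrite eq_card; case: #|ridges _ y s t| => [|[|[|k]]] le_h.
  - by constructor 1.
  - by constructor 2; rewrite mul1n.
  - by constructor 3; rewrite mul2n.
  - by exfalso; move: le_h; rewrite !mulSn; move: (k * h) => l; arith_lia.
pose same s := #|[set t in K | #|At s :&: At t| == h.*2]|.
pose opp s := #|[set t in K | #|At s :&: At t| == 0]|.
(* The intersections with the 2M + 1 coatoms add up to 2hM. Each has size h, corrected by -h for
   disjoint coatoms and +h for coatoms with the same atoms. *)
have oppE s : s \in K -> opp s = (same s).+1.
  move=> sK; have sumE : \sum_(t in K) #|At s :&: At t| = h.*2 * M.
    rewrite sum_common_atoms // -(cardAt s sK) -sum_nat_const.
    have [_ le_sy rs] := levelP _ _ _ _ _ sK.
    apply: eq_bigr => v vs; have [_ le_vs rv] := levelP _ _ _ _ _ vs.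
    rewrite r_bot in rv; apply: card_coatoms_B => //; try arith_lia.
      exact: atoms_neq0 vs.
    exact: le_trans le_vs le_sy.
  have cardE (Q : pred T) : #|[set t in K | Q t]| = \sum_(t in K) Q t.
    by rewrite -sum1dep_card big_mkcondr; apply: eq_bigr => t _; case: (Q t).
  have : \sum_(t in K) (#|At s :&: At t| + h * (#|At s :&: At t| == 0)) =
         \sum_(t in K) (h + h * (#|At s :&: At t| == h.*2)).
    have h0 : (h == 0) = false by apply/eqP; arith_lia.
    have h2 : (h == h.*2) = false by apply/eqP; arith_lia.
    apply: eq_bigr => t tK; have [->|->|->] := common s t sK tK; rewrite ?eqxx.
    - by rewrite eq_sym double_eq0 h0 muln0 muln1 addn0.
    - by rewrite h0 h2.
    - by rewrite double_eq0 h0 muln0 muln1 addn0 addnn.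
  rewrite !big_split /= sumE -!big_distrr /= -!cardE -/(opp s) -/(same s).
  rewrite sum_nat_const cardK c_eq => eq_sum; apply/eqP.
  rewrite -(eqn_pmul2l h_gt0); apply/eqP.
  by move: eq_sum; move: (opp s) (same s) => o a; arith_nia.
(* Here V = 4h + 2h/M < 5h because M > 2. If [t] and [u] shared at most h atoms, the three coatoms
   would have at least 5h atoms together. *)
have opp_same s t u : s \in K -> t \in K -> u \in K ->
    #|At s :&: At t| = 0 -> #|At s :&: At u| = 0 -> #|At t :&: At u| = h.*2.
  move=> sK tK uK st su.
  have : #|At s :|: (At t :|: At u)| <= V.
    by rewrite subset_leq_card // !subUset !sAt.
  rewrite cardsU setIUr; have -> : #|At s :&: At t :|: At s :&: At u| = 0.
    by rewrite cardsU st su.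
  rewrite cardsU !cardAt // => le_V.
  by have [e|e|//] := common t u tK uK; rewrite e in le_V; exfalso; arith_nia.
have same_opp s t u : s \in K -> t \in K -> u \in K ->
    #|At s :&: At t| = 0 -> #|At t :&: At u| = h.*2 -> #|At s :&: At u| = 0.
  move=> sK tK uK st tu.
  have eq_t : At t :&: At u = At t.
    by apply/eqP; rewrite eqEcard subsetIl tu cardAt ?leqnn.
  have eq_u : At t :&: At u = At u.
    by apply/eqP; rewrite eqEcard subsetIr tu cardAt ?leqnn.
  by rewrite -eq_u eq_t.
have opp_eq s t : s \in K -> t \in K -> #|At s :&: At t| = 0 -> opp s = same t.
  move=> sK tK st; apply: eq_card => u; apply/setIdP/setIdP.
    by case=> uK /eqP su; split=> //; apply/eqP; exact: (opp_same s t u).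
  by case=> uK /eqP tu; split=> //; apply/eqP; exact: (same_opp s t u).
have [||s sK] := @coatom_exists \bot%O y; rewrite ?r_bot ?ry ?le0x //.
have [t] : exists t, t \in [set t in K | #|At s :&: At t| == 0].
  by apply/card_gt0P; rewrite -/(opp s) oppE.
case/setIdP=> tK /eqP st.
have ts : #|At t :&: At s| = 0 by rewrite setIC.
(* The contradiction is the cycle [opp s] = [same t] < [opp t] = [same s] < [opp s]. *)
have := oppE s sK; have := oppE t tK; rewrite (opp_eq s t) // (opp_eq t s) //.
by arith_lia.
Qed.

End BooleanBelow.

(** * The Eulerian condition as relations among the values of B and D *)

Section EulerRelations.
Local Open Scope ring_scope.

Lemma euler_level_sum x y : (x < y)%O ->
  \sum_(0 <= k < (r y).+1) (-1) ^+ k * #|level x y k|%:R = 0 :> rat.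
Proof.
move=> lt_xy; rewrite big_mkord.
rewrite -[RHS](sum_alternating_parity (eulerian_r lt_xy)).
rewrite [RHS](partition_big (fun z => inord (r z) : 'I_(r y).+1) predT) //=.
apply: eq_bigr => k _; rewrite mulr_natr -sumr_const; apply: eq_big => z.
  rewrite !inE; case: (x <= z)%O => //=; case le_zy : (z <= y)%O => //=.
  by rewrite -val_eqE /= inordK // ltnS (rank_le r_covers).
by case/levelP=> _ _ ->.
Qed.

(** The level sizes are B n / (B i * B (n - i)); the alternating sum is shifted by the rank of [x]
    and divided by B n and the sign of that shift. *)
Lemma euler_B x y n : x != \bot%O -> (x <= y)%O -> (r y = r x + n)%N -> (0 < n)%N ->
  \sum_(0 <= i < n.+1) (-1) ^+ i / (B i * B (n - i))%:R = 0 :> rat.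
Proof.
move=> x0 le_xy ry n_gt0.
have lt_xy : (x < y)%O.
  rewrite lt_neqAle le_xy andbT; apply/eqP => eq_xy.
  by move: ry n_gt0; rewrite eq_xy; lia.
have Bn_gt0 : (0 < B n)%N.
  by rewrite -(addKn (r x) n) -ry -chainsB // card_max_chains_gt0.
have := euler_level_sum lt_xy.
rewrite (big_cat_nat (n := r x)) //=; last by rewrite ry; lia.
rewrite big_nat big1 ?add0r; last first.
  move=> k /andP[_ lt_k]; rewrite (_ : #|_| = 0%N) ?mulr0 //; apply: eq_card0 => z.
  apply/negP => /levelP[/(rank_le r_covers) le_r _ rz]; rewrite rz in le_r.
  by rewrite leqNgt lt_k in le_r.
rewrite -{1}[r x]add0n big_addn (_ : (r y).+1 - r x = n.+1)%N; last by lia.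
move=> E.
rewrite -[RHS](mulr0 ((-1) ^+ r x / (B n)%:R)) -[X in _ = _ * X]E mulr_sumr.
apply: eq_big_nat => i /andP[_ lt_i].
have k_in : (r x <= i + r x <= r y)%N by lia.
have := level_B x0 le_xy k_in.
have -> : (r y - r x = n)%N by lia.
have -> : (i + r x - r x = i)%N by lia.
have -> : (r y - (i + r x) = n - i)%N by lia.
move=> Bn; move: Bn_gt0; rewrite Bn muln_gt0 => /andP[L_gt0 BB_gt0].
rewrite exprD !natrM.
set L := #|_|%:R; set X := (B i)%:R; set Y := (B (n - i))%:R.
have sgn : (-1) ^+ r x * (-1) ^+ r x = 1 :> rat by rewrite -expr2 sqrr_sign.
have nzL : L != 0 by rewrite pnatr_eq0 -lt0n.
have : X * Y != 0 by rewrite -natrM pnatr_eq0 -lt0n.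
rewrite mulf_eq0 negb_or => /andP[nzX nzY].
transitivity (((-1) ^+ r x * (-1) ^+ r x) * ((-1) ^+ i / (X * Y))).
  by rewrite sgn mul1r.
by field; rewrite nzL nzX nzY.
Qed.

(** The level of rank 0 consists of the minimum alone and yields the right side; the index i stands
    for rank i + 1. *)
Lemma euler_D y n : r y = n.+1 ->
  \sum_(0 <= i < n.+1) (-1) ^+ i / (D i.+1 * B (n.+1 - i.+1))%:R =
  (D n.+1)%:R^-1 :> rat.
Proof.
move=> ry.
have lt_y : (\bot < y)%O.
  by rewrite lt0x; apply/eqP => y0; rewrite y0 r_bot in ry.
have Dn_gt0 : (0 < D n.+1)%N by rewrite -ry -chainsD card_max_chains_gt0.
have := euler_level_sum lt_y; rewrite big_nat_recl // ry expr0 mul1r.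
have -> : #|level \bot%O y 0| = 1%N.
  apply: (@eq_card1 _ \bot%O) => z; apply/levelP/eqP => [[_ _ rz]|->].
    by apply/esym/(eq_rank_le r_covers (le0x z)); rewrite r_bot.
  by rewrite le0x r_bot.
move/eqP; rewrite addrC addr_eq0 => /eqP E.
rewrite -[RHS]mul1r -[X in X / _]opprK -[X in (- X) / _]E.
rewrite -sumrN mulr_suml; apply: eq_big_nat => i /andP[_ lt_i].
have k_in : (0 < i.+1 <= r y)%N by lia.
have := level_D k_in; rewrite ry.
move=> Dn; move: Dn_gt0; rewrite Dn muln_gt0 => /andP[L_gt0 BB_gt0].
rewrite exprS !natrM.
set L := #|_|%:R; set X := (D _)%:R; set Y := (B _)%:R.
have nzL : L != 0 by rewrite pnatr_eq0 -lt0n.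
have : X * Y != 0 by rewrite -natrM pnatr_eq0 -lt0n.
rewrite mulf_eq0 negb_or => /andP[nzX nzY].
by field; rewrite nzL nzX nzY.
Qed.

End EulerRelations.

(** * Existence of intervals of given length, and first values of D and B *)

Lemma rank_exists k : k <= r \top%O -> exists y, r y = k.
Proof.
move=> le_k; have k_in : r \bot%O <= k <= r \top%O by rewrite r_bot.
by have [y /levelP[_ _ ry]] := level_exists r_covers (le0x _) k_in; exists y.
Qed.

Lemma atom_exists y : 0 < r y -> exists x, [/\ x != \bot%O, (x <= y)%O & r x = 1].
Proof.
move=> ry_gt0; have k_in : r \bot%O <= 1 <= r y by rewrite r_bot.
have [x /levelP[_ le_xy rx]] := level_exists r_covers (le0x y) k_in.
by exists x; split=> //; apply/eqP => x0; rewrite x0 r_bot in rx.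
Qed.

Lemma interval_exists k : k < r \top%O ->
  exists x y, [/\ x != \bot%O, (x <= y)%O & r y = r x + k].
Proof.
move=> lt_k; have [y ry] := rank_exists lt_k.
have [|x [x0 le_xy rx]] := @atom_exists y; first by rewrite ry.
by exists x, y; split=> //; rewrite rx ry.
Qed.

Lemma card_max_chains_cover x y : (x <= y)%O -> r y = (r x).+1 -> #|max_chains x y| = 1.
Proof.
move=> le_xy ry; have lt_xy : (x < y)%O.
  rewrite lt_neqAle le_xy andbT; apply/eqP => eq_xy; move: ry; rewrite eq_xy; lia.
rewrite card_max_chains_rec // (big_pred1 y) ?max_chains_id ?cards1 // => w /=.
rewrite (coversE r_covers); apply/andP/eqP => [[/andP[lt_xw /eqP rw] le_wy]|->].
  by apply: (eq_rank_le r_covers le_wy); rewrite rw.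
by rewrite lt_xy ry eqxx lexx.
Qed.

Lemma D0_eq1 : D 0 = 1.
Proof. by have := chainsD \bot%O; rewrite r_bot max_chains_id cards1. Qed.

Lemma D1_eq1 : 0 < r \top%O -> D 1 = 1.
Proof.
case/rank_exists=> y ry; have := chainsD y.
by rewrite ry card_max_chains_cover ?le0x ?r_bot.
Qed.

Lemma B0_eq1 : 0 < r \top%O -> B 0 = 1.
Proof.
case/interval_exists=> x [_ [x0 _ _]].
by have := chainsB x0 (lexx x); rewrite subnn max_chains_id cards1.
Qed.

Lemma B1_eq1 : 1 < r \top%O -> B 1 = 1.
Proof.
case/interval_exists=> x [y [x0 le_xy ry]].
by have := chainsB x0 le_xy; rewrite card_max_chains_cover ?ry ?addn1 ?subSnn.
Qed.

Lemma B_even n : ~~ odd n -> 0 < n < r \top%O ->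
  (forall j, j < n -> B j = j`!) -> B n = n`!.
Proof.
move=> even_n /andP[n_gt0 /interval_exists[x [y [x0 le_xy ry]]]] HB.
apply: (@euler_solve_B B n) => //.
exact: (euler_B x0 le_xy ry).
Qed.

Lemma D_even n : odd n -> n < r \top%O -> (forall j, j <= n -> B j = j`!) ->
  (forall j, 0 < j <= n -> D j = cubeD j) -> D n.+1 = cubeD n.+1.
Proof.
move=> odd_n /rank_exists[y ry] HB HD; apply: (@euler_solve_D D B) => //.
exact: (euler_D ry).
Qed.

(** * The induction over even M *)

Definition cubical_up_to M :=
  (forall j, j <= M -> B j = j`!) /\ (forall j, 0 < j <= M -> D j = cubeD j).

(** [B M.+2] is left out because an interval of length M + 2 above an atom need not exist when M + 2
    is the rank of the poset. *)
Lemma cubical_step M : ~~ odd M -> 3 < M -> M.+1 < r \top%O -> cubical_up_to M ->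
  [/\ B M.+1 = M.+1`!, D M.+1 = cubeD M.+1 & D M.+2 = cubeD M.+2].
Proof.
move=> even_M M_gt3 lt_M [HB HD].
have M_gt2 : 2 < M by lia.
have M_gt0 : 0 < M by lia.
have B1 : B 1 = 1 by rewrite HB.
have D1 : D 1 = 1 by rewrite HD.
have [y ry] := rank_exists lt_M.
have [|x [x0 le_xy rx]] := @atom_exists y; first by rewrite ry.
have [||s /levelP[_ le_sy]] := coatom_exists (x := \bot%O) (y := y).
- by rewrite r_bot ry.
- exact: le0x.
rewrite ry /= => rs.
have [||z /levelP[_ le_zs]] := coatom_exists (x := \bot%O) (y := s).
- by rewrite r_bot rs.
- exact: le0x.
rewrite rs /= => rz.
set q := 2 ^ (M - 1); have q_gt0 : 0 < q by rewrite expn_gt0.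
have ryx : r y = r x + M.+1 by rewrite rx ry.
have Ba := card_level_coatoms_B x0 le_xy ryx.
have Dc := card_level_coatoms_D M_gt0 rs.
have DC := card_level_coatoms_D (ltn0Sn M) ry.
rewrite B1 (HB M) // muln1 in Ba; rewrite B1 muln1 in Dc; rewrite B1 muln1 in DC.
set a := #|coatoms x y| in Ba; set c := #|coatoms _ s| in Dc.
set C := #|coatoms _ y| in DC.
have /and3P[C_gt0 c_gt0 DM_gt0] : [&& 0 < C, 0 < c & 0 < D M].
  by rewrite -!muln_gt0 -Dc -DC -ry -chainsD card_max_chains_gt0.
have a_gt0 : 0 < a.
  have : 0 < B M.+1 by rewrite -(addKn (r x) M.+1) -ryx -chainsB // card_max_chains_gt0.
  by rewrite Ba muln_gt0 => /andP[].
have Vs := card_atoms_DS M_gt2 HB HD rs Dc.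
(* The 2^(M-1) atoms of [z] are among the c 2^(M-1) / M atoms of [s]. *)
have le_Mc : M <= c.
  rewrite -(leq_pmul2r q_gt0) -Vs mulnC leq_pmul2r // /q.
  have M_in : 0 < M <= M by rewrite M_gt0 leqnn.
  rewrite -(card_atoms_D M_gt2 HB HD M_in rz).
  exact/subset_leq_card/atomsS.
(* Counting through atoms, C / a is the number of atoms of [y] divided by that of [s], and [s] lies
   below [y]. *)
have le_aC : a <= C.
  have D1s := card_level_atoms_D rs.
  have D1y := card_level_atoms_D ry.
  rewrite D1 mul1n (HB M) // in D1s; rewrite D1 mul1n Ba in D1y.
  have DS_gt0 : 0 < D M.+1 by rewrite Dc muln_gt0 c_gt0.
  rewrite -(leq_pmul2r DS_gt0) -DC D1y D1s mulnCA leq_mul2r; apply/orP; right.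
  exact/subset_leq_card/atomsS.
have E : 2 * q * M.+1 * c * C + 2 * M * M.+1 * a * C =
         4 * M * M.+1 * a + 2 * q * a * c * C + M * a * c * C.
  apply: euler_nat_relation => //.
  have := euler_D ry.
  move/(euler_solve_D2 even_M M_gt0 HB HD).
  by rewrite DC Dc Ba (HD M) // M_gt0 leqnn.
have a_lt := nat_relation_a_lt M_gt3 (double_leq_expn M_gt3) le_Mc a_gt0 E.
have aE := B_ratio_eq M_gt2 HB x0 le_xy ryx Ba a_lt.
have BS : B M.+1 = M.+1`! by rewrite Ba aE -factS.
have lt_c : c < M.*2 -> c < C.
  exact: (cube_coatoms_lt M_gt2 HB HD ry BS Dc DC c_gt0).
have neq_c := cube_coatoms_neq M_gt2 HB HD rs Dc.
rewrite aE in E le_aC.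
have [cE CE] := nat_relation_solve M_gt3 le_aC lt_c neq_c E.
have DS : D M.+1 = cubeD M.+1 by rewrite Dc cE cubeDS ?HD ?M_gt0 ?leqnn.
by split=> //; rewrite DC CE DS -cubeDS.
Qed.

(** The Euler relations give the values at 2 and 4; those at 3 are the assumptions. *)
Lemma cubical_up_to4 : 5 < r \top%O -> B 3 = 6 -> D 3 = 8 -> cubical_up_to 4.
Proof.
move=> lt5 B3 D3.
have B0 : B 0 = 1 by apply: B0_eq1; lia.
have B1 : B 1 = 1 by apply: B1_eq1; lia.
have D1 : D 1 = 1 by apply: D1_eq1; lia.
have B2 : B 2 = 2 by apply: (@B_even 2) => // [|[|[|]]] //; lia.
have D2 : D 2 = 2.
  apply: (@D_even 1) => // [|[|[|]]|[|[|]]] //; lia.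
have B4 : B 4 = 24.
  apply: (@B_even 4) => // [|[|[|[|[|]]]]] //; lia.
have D4 : D 4 = 48.
  by apply: (@D_even 3) => // [|[|[|[|[|]]]]|[|[|[|[|]]]]] //; lia.
by split; [case=> [|[|[|[|[|]]]]] | case=> [|[|[|[|[|]]]]]].
Qed.

Lemma cubical_all i : i.*2 + 5 < r \top%O -> B 3 = 6 -> D 3 = 8 ->
  cubical_up_to (i.*2 + 4).
Proof.
move=> lt_i B3 D3; elim: i lt_i => [|i IH] lt_i; first exact: cubical_up_to4.
have [HB HD] : cubical_up_to (i.*2 + 4) by apply: IH; lia.
set M := i.*2 + 4 in HB HD; have -> : i.+1.*2 + 4 = M.+2 by rewrite /M; lia.
have even_M : ~~ odd M by rewrite /M; lia.
have [|||BS DS DSS] := @cubical_step M even_M; rewrite /M; try lia; first by [].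
rewrite -/M in BS DS DSS.
have HB1 j : j < M.+2 -> B j = j`!.
  rewrite ltnS leq_eqVlt => /orP[/eqP->//|lt_j]; exact: HB.
(* Since M + 2 is still below the rank, the Euler relation of an interval above an atom supplies
   this value. *)
have BSS : B M.+2 = M.+2`!.
  by apply: B_even => //; [rewrite /= negbK | rewrite /M; lia].
split=> j.
  by rewrite leq_eqVlt => /orP[/eqP->//|lt_j]; apply: HB1.
case/andP=> j_gt0; rewrite leq_eqVlt => /orP[/eqP->//|].
rewrite ltnS leq_eqVlt => /orP[/eqP->//|lt_j]; apply: HD.
by rewrite j_gt0.
Qed.

End EulerianSheffer.

Theorem theorem4p6 (d : Order.disp_t) (P : finTBPOrderType d)
    (D B : nat -> nat) (n m : nat)
    (P_eulerian : eulerian P)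
    (P_sheffer : sheffer_poset P D B)
    (P_rank : poset_rank P = n)
    (n_even : n = 2 * m + 2)
    (n_ge6 : 6 <= n)
    (B3 : B 3 = 6)
    (D3 : D 3 = 8) :
  [/\ sheffer_poset (cubical_lattice n) D B,
      forall k : nat, 1 <= k <= n -> D k = 2 ^ (k - 1) * (k - 1)`!
    & forall k : nat, 1 <= k <= n - 1 -> B k = k`!].
Proof.
case: P_sheffer => graded chD chB; case: P_eulerian => _ euler.
have r_covers := rank_covers graded; have r_bot := rank_bot graded.
have chB' (x y : P) : x != \bot%O -> (x <= y)%O ->
    #|max_chains x y| = B (rank y - rank x).
  by move=> x0 le_xy; rewrite chB // (rank_add graded le_xy) addKn.
have rT : rank (\top%O : P) = n := P_rank.
(* The induction reaches M = n - 2; one further step gives the values at n - 1 and the value of [D]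
   at n. *)
pose M := (m - 2).*2 + 4; have nE : n = M.+2 by rewrite /M; lia.
have [HB HD] : cubical_up_to D B M.
  by apply: (cubical_all r_covers r_bot chD chB' euler) => //; rewrite rT /M; lia.
have [||||BS DS DSS] := cubical_step r_covers r_bot chD chB' euler (M := M) => //.
- by rewrite /M; lia.
- by rewrite /M; lia.
- by rewrite rT nE.
have HDn k : 1 <= k <= n -> D k = 2 ^ (k - 1) * (k - 1)`!.
  rewrite nE => /andP[k_gt0]; rewrite leq_eqVlt => /orP[/eqP->//|].
  rewrite ltnS leq_eqVlt => /orP[/eqP->//|lt_k]; apply: HD.
  by rewrite k_gt0.
have HBn k : 1 <= k <= n - 1 -> B k = k`!.
  rewrite nE subn1 /= => /andP[_]; rewrite leq_eqVlt => /orP[/eqP->//|lt_k].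
  exact: HB.
split=> //; apply: cube_sheffer.
- exact: D0_eq1 r_bot chD.
- exact: HB.
- by move=> k; rewrite prednK; [apply: HDn | lia].
- by move=> k; rewrite -subn1; apply: HBn.
Qed.
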